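(* Let $U$ be a region in $\mathbb{R}^3$ and let $g$ be a Riemannian metric on $U$. If all geodesics of $g$ in $U$ are circles (or parts of circles), then $g$ has constant curvature.
   Context: Geodesics are considered as unparametrized curves, i.e. the condition says that the image of each geodesic of $g$ is contained in a (Euclidean) circle of $\mathbb{R}^3$. Constant curvature means constant sectional curvature. *)

(* Defs.v *)
From HB Require Import structures.
From mathcomp Require Import all_boot all_order all_algebra.
From mathcomp Require Import all_classical all_reals all_analysis.
Set Implicit Arguments.
Unset Strict Implicit.
Unset Printing Implicit Defensive.
Import Order.TTheory GRing.Theory Num.Theory.
Import numFieldNormedType.Exports.
Local Open Scope classical_set_scope.
Local Open Scope ring_scope.

(* Points and tangent vectors of R^(n.+1) are row vectors; a field of bilinear
   forms is a map into the square matrices. *)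

Section Smooth.
Context {R : realType} {n : nat}.
Local Notation E := 'rV[R]_n.+1.

Definition partial (i : 'I_n.+1) (f : E -> R) (x : E) : R :=
  'D_(delta_mx 0 i) f x.

(* Only the restriction of f to U matters here, provided that U is open. *)
Fixpoint class_C (k : nat) (U : set E) (f : E -> R) : Prop :=
  (forall x, U x -> {for x, continuous f}) /\
  if k is k'.+1 then
    forall i : 'I_n.+1,
      (forall x, U x -> derivable f x (delta_mx 0 i)) /\
      class_C k' U (partial i f)
  else True.

Definition smooth (U : set E) (f : E -> R) : Prop := forall k, class_C k U f.

Definition region (U : set E) : Prop := open U /\ connected U.

End Smooth.

Section Riemannian.
Context {R : realType} {n : nat}.
Local Notation E := 'rV[R]_n.+1.
Local Notation metric := (E -> 'M[R]_n.+1).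

Definition bform (G : 'M[R]_n.+1) (u v : E) : R := (u *m G *m v^T) 0 0.

Definition riemannian_metric (U : set E) (g : metric) : Prop :=
  [/\ forall i j, smooth U (fun x => g x i j),
      forall x, U x -> (g x)^T = g x
    & forall x, U x -> forall v : E, v != 0 -> 0 < bform (g x) v v].

(* Gamma^k_ij, with the upper index as first argument *)
Definition christoffel (g : metric) (k i j : 'I_n.+1) (x : E) : R :=
  2^-1 * \sum_l invmx (g x) k l *
    (partial i (fun y => g y j l) x + partial j (fun y => g y i l) x
     - partial l (fun y => g y i j) x).

(* Affinely parametrized geodesics, on arbitrary open intervals; constant
   curves are included. *)
Definition geodesic (U : set E) (g : metric) (I : set R) (c : R -> E) : Prop :=
  [/\ open I, is_interval I, forall t, I t -> U (c t),
      forall t, I t -> derivable c t 1 /\ derivable (derive1 c) t 1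
    & forall t, I t -> forall k,
        derive1 (derive1 c) t 0 k
        + \sum_i \sum_j christoffel g k i j (c t) * derive1 c t 0 i * derive1 c t 0 j
        = 0].

(* R(d_i, d_j) d_k = \sum_l (riemann_coef g l k i j) d_l, with the sign
   convention R(X, Y) Z = D_X D_Y Z - D_Y D_X Z - D_[X, Y] Z. *)
Definition riemann_coef (g : metric) (l k i j : 'I_n.+1) (x : E) : R :=
  partial i (christoffel g l j k) x - partial j (christoffel g l i k) x
  + \sum_m (christoffel g l i m x * christoffel g m j k x
            - christoffel g l j m x * christoffel g m i k x).

Definition riemann (g : metric) (x u v w : E) : E :=
  \row_l \sum_i \sum_j \sum_k
    riemann_coef g l k i j x * u 0 i * v 0 j * w 0 k.

(* sectional curvature of the plane spanned by u and v *)
Definition sectional (g : metric) (x u v : E) : R :=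
  bform (g x) (riemann g x u v v) u /
  (bform (g x) u u * bform (g x) v v - bform (g x) u v ^+ 2).

Definition constant_curvature (U : set E) (g : metric) : Prop :=
  exists K : R, forall x, U x ->
    forall u v : E, row_free (col_mx u v) -> sectional g x u v = K.

End Riemannian.

Section Circles.
Context {R : realType} {n : nat}.
Local Notation E := 'rV[R]_n.+1.

(* The rows of P span the direction of the plane of the circle. *)
Definition round_circle (C : set E) : Prop :=
  exists (c : E) (r : R) (P : 'M[R]_(2, n.+1)),
    [/\ 0 < r, row_free P
      & C = [set x | (x - c <= P)%MS /\ bform 1%:M (x - c) (x - c) = r ^+ 2]].

Definition straight_line (C : set E) : Prop :=
  exists p v : E, v != 0 /\ C = [set x | (x - p <= v)%MS].

(* Straight lines are circles of infinite radius.  They cannot be left out: for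
   any metric on an open subset of R^3, the Euclidean curvature vectors of the
   geodesics through a point form a continuous tangent field on the sphere of
   directions, which has a zero, so no nonempty U would have only round
   circles as geodesics. *)
Definition circle (C : set E) : Prop := round_circle C \/ straight_line C.

End Circles.

Definition geodesics_are_circles {R : realType} {n : nat}
    (U : set 'rV[R]_n.+1) (g : 'rV[R]_n.+1 -> 'M[R]_n.+1) : Prop :=
  forall (I : set R) (c : R -> 'rV[R]_n.+1),
    geodesic U g I c -> exists2 C, circle C & c @` I `<=` C.

(* Main.v *)
Require Import Defs.
From HB Require Import structures.
From mathcomp Require Import all_boot all_order all_algebra.
From mathcomp Require Import all_classical all_reals all_analysis.
From mathcomp Require Import ring lra.
Set Implicit Arguments.
Unset Strict Implicit.
Unset Printing Implicit Defensive.
Import Order.TTheory GRing.Theory Num.Theory.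
Import numFieldNormedType.Exports.
Local Open Scope classical_set_scope.
Local Open Scope ring_scope.

(** Write F(v) for the acceleration - Gamma(v, v) of the geodesic through x
    with velocity v, J(v) for its third derivative, and <,> for the Euclidean
    product of R^3.  Differentiating three times the equations of a circle
    gives the pointwise identity

      |v|^2 J(v) - 3 <F(v), v> F(v) is parallel to v        for all v

    ([geodesic_circle_identity]).  It is polynomial in v, so it also holds at
    complex v, and all the information comes from the isotropic vectors
    v = a + i b, where a and b are orthogonal of the same length and
    |v|^2 = 0.  Evaluation at a + i b is carried out over the reals, as the
    remainder modulo 1 + s^2 of a polynomial in s along the line a + s b.

    At an isotropic v, the identity gives <F(v), v>^2 = 0
    ([acc_isotropic]).  Hence the cubic form <F(v), v> is |v|^2 lambda(v) for
    a linear form lambda depending smoothly on x ([acc_radial]).  Then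
    differentiating this equality along the geodesic gives
    <J(v), v> = - |F(v)|^2 modulo |v|^2 ([jerk_energy]), whereas the identity
    above, divided by |v|^2, gives <J(v), v> = 0 modulo |v|^2.  So at an
    isotropic v the vector F(v) is isotropic and orthogonal to v, that is,
    parallel to v ([christoffel_normal]).  This forces the normal form

      F(v) = |v|^2 m - 2 p(v) v

    with a vector field m and a one-form p ([christoffel_form]).  Put back
    into the identity, it says that d_i m_j = m_i m_j + rho delta_ij for
    some function rho ([mcoef_derivative]).

    The connection is now projectively flat, and the rest is Beltrami's
    theorem followed by Schur's lemma.  The curvature is
    R^l_kij = delta_lj Q_ik - delta_li Q_jk for some Q; the antisymmetry of
    the Riemann tensor of a metric, that is, the symmetry of the second
    derivatives of g, forces Q = - K g ([curvature_contraction]); the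
    symmetry of the second derivatives of p forces dK = 0
    ([projectively_flat_curvature]), and U is connected.

    The hypothesis speaks of geodesics only, so geodesics with arbitrary
    initial conditions are needed: they come from Picard iteration
    ([picard], [geodesic_exists]). *)

(** * Mean value inequality and primitives *)

Section MeanValue.
Context {R : realType}.

Lemma MVT_any (f df : R -> R) (a b : R) :
  (forall t, Num.min a b <= t <= Num.max a b -> is_derive t 1 f (df t)) ->
  exists2 c, Num.min a b <= c <= Num.max a b & f b - f a = df c * (b - a).
Proof.
wlog ab : a b / a <= b.
  move=> H; have [ab|] := boolP (a <= b); first exact: H.
  rewrite -ltNge => /ltW ba df_.
  have [|c c1 c2] := H b a ba; first by rewrite minC maxC.
  by exists c; [rewrite minC maxC | rewrite -opprB c2 -mulrN opprB].
rewrite min_l// max_r// => df_.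
have [||c c1 c2] := @MVT_segment R f df a b ab.
- move=> x /[!in_itv]/= /andP[h1 h2]; apply: df_; rewrite !ltW//.
- apply: derivable_within_continuous => x /[!in_itv]/= h.
  by have /@ex_derive := df_ _ h.
by exists c => //; move: c1; rewrite in_itv.
Qed.

Lemma derive_bounded_lipschitz (f df : R -> R) (C e a b : R) :
  (forall t : R, `|t| <= e -> is_derive t 1 f (df t)) ->
  (forall t, `|t| <= e -> `|df t| <= C) ->
  `|a| <= e -> `|b| <= e -> `|f b - f a| <= C * `|b - a|.
Proof.
move=> fdf dfC ae be.
have h t : Num.min a b <= t <= Num.max a b -> `|t| <= e.
  move: ae be; rewrite !ler_norml ge_min le_max.
  case: (leP a b) => ab /andP[? ?] /andP[? ?] /andP[/orP h1 /orP h2].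
    by lra.
  by lra.
have [t /h te ->] := @MVT_any f df a b (fun t ht => fdf t (h t ht)).
by rewrite normrM ler_wpM2r// dfC.
Qed.

(** Integrating from - T rather than from 0 gives the derivative on both sides
    of 0 at once; the constant of integration is corrected afterwards. *)
Lemma continuous_primitive (f : R -> R) (T : R) : 0 < T -> continuous f ->
  exists2 F : R -> R, F 0 = 0 & forall t : R, `|t| < T -> is_derive t 1 F (f t).
Proof.
move=> T0 cf.
pose F x := (\int[lebesgue_measure]_(t in `[- T, x]) f t)%R.
exists (fun x => F x - F 0); first by rewrite subrr.
move=> t /[!ltr_norml] /andP[Tt tT].
have := @continuous_FTC1_closed R f (- T) t T tT.
move=> [|||dF F'].
- apply: continuous_compact_integrable; first exact: segment_compact.
  by apply: continuous_subspaceT.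
- exact: Tt.
- exact: cf.
- have h : is_derive t 1 F (f t).
    by rewrite -F' derive1E; apply/derivableP.
  have := is_deriveB h (is_derive_cst (F 0) t 1).
  by rewrite subr0.
Qed.
End MeanValue.

(** * Existence for Lipschitz differential equations *)

Section Picard.
Context {R : realType}.

(** Inequalities up to a geometrically small error, as they arise from the
    iterates below, pass to the limit. *)
Lemma le_geometric_eps (a b c : R) : (forall n : nat, a <= b + c * 2^-1 ^+ n) -> a <= b.
Proof.
move=> h; rewrite leNgt; apply/negP => ba.
have c0 : 0 <= `|c| by [].
pose q := `|c| / (a - b); have ab0 : 0 < a - b by rewrite subr_gt0.
have [n qn] : exists n : nat, q < n%:R.
  by exists (Num.bound q); apply: le_lt_trans (archi_boundP _); rewrite ?ler_norm ?divr_ge0// ltW.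
have n2 : n%:R <= 2 ^+ n :> R by rewrite -natrX ler_nat ltnW// ltn_expl.
have := h n; rewrite exprVn => hn.
have p2 : 0 < 2 ^+ n :> R by rewrite exprn_gt0.
have : a - b <= `|c| / 2 ^+ n.
  rewrite lerBlDl (le_trans hn)// lerD2l.
  by apply: ler_wpM2r; [rewrite invr_ge0 ltW|exact: ler_norm].
rewrite ler_pdivlMr// mulrC -ler_pdivlMr// leNgt => /negP; apply.
exact: lt_le_trans qn n2.
Qed.

(** The sequences a n - 2 / 2^n and a n + 2 / 2^n are monotone and enclose each
    other, so the supremum of the first is the limit. *)
Lemma geometric_cauchy_limit (a : nat -> R) :
  (forall n, `|a n.+1 - a n| <= 2^-1 ^+ n) ->
  exists l, forall n, `|a n - l| <= 2 * 2^-1 ^+ n.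
Proof.
move=> h.
pose u n := a n - 2 * 2^-1 ^+ n; pose v n := a n + 2 * 2^-1 ^+ n.
have pos n : 0 < 2^-1 ^+ n :> R by rewrite exprn_gt0// invr_gt0.
have uS n : u n <= u n.+1.
  rewrite /u exprS mulrA divff// mul1r; have := h n; rewrite ler_norml.
  by move=> /andP[? ?]; lra.
have vS n : v n.+1 <= v n.
  rewrite /v exprS mulrA divff// mul1r; have := h n; rewrite ler_norml.
  by move=> /andP[? ?]; lra.
have uD n k : u n <= u (n + k)%N.
  by elim: k => [|k IH]; rewrite ?addn0// addnS (le_trans IH).
have vD n k : v (n + k)%N <= v n.
  by elim: k => [|k IH]; rewrite ?addn0// addnS (le_trans _ IH).
have uv n m : u n <= v m.
  apply: (le_trans (uD n m)); rewrite addnC; apply: le_trans (vD m n).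
  by rewrite /u /v; have := pos (m + n)%N; lra.
exists (sup (range u)) => n.
have hsup : has_sup (range u).
  by split; [exists (u 0%N), 0%N | exists (v 0%N) => _ [m _ <-]].
have h1 : u n <= sup (range u) by apply: ub_le_sup; [case: hsup | exists n].
have h2 : sup (range u) <= v n.
  by apply: ge_sup; [case: hsup | move=> _ [m _ <-]].
by rewrite /u in h1; rewrite /v in h2; rewrite ler_norml; apply/andP; split; lra.
Qed.

Lemma lipschitz_continuous (f : R -> R) (C : R) :
  (forall s t, `|f t - f s| <= C * `|t - s|) -> continuous f.
Proof.
move=> h x; apply/cvgrPdist_lt => e e0.
have C1 : 0 < `|C| + 1 by rewrite ltr_wpDl.
near=> t.
rewrite (le_lt_trans (h _ _))//.
apply: (@le_lt_trans _ _ ((`|C| + 1) * `|x - t|)).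
  by rewrite ler_wpM2r// (le_trans (ler_norm C))// lerDl.
rewrite mulrC -ltr_pdivlMr//.
by near: t; apply: cvgr_dist_lt; rewrite // divr_gt0.
Unshelve. all: by end_near. Qed.

(** Truncation extends a field known near a point to a bounded field on the
    whole space, without spoiling Lipschitz bounds. *)
Definition clamp (a b t : R) : R := Num.max a (Num.min b t).

Lemma clamp_in a b t : a <= b -> a <= clamp a b t <= b.
Proof. by move=> ab; rewrite /clamp le_max lexx/= ge_max ab ge_min lexx. Qed.

Lemma clamp_id a b t : a <= t <= b -> clamp a b t = t.
Proof. by move=> /andP[at_ tb]; rewrite /clamp min_r// max_r. Qed.

Lemma clamp_lip a b s t : `|clamp a b t - clamp a b s| <= `|t - s|.
Proof.
have hmax x y : `|Num.max a x - Num.max a y| <= `|x - y|.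
  have := ler_norm (x - y); have := ler_norm (- (x - y)); rewrite normrN ler_norml.
  by have [?|?] := ltP a x; have [?|?] := ltP a y => ? ?; apply/andP; split; lra.
apply: (le_trans (hmax _ _)).
have := ler_norm (t - s); have := ler_norm (- (t - s)); rewrite normrN ler_norml.
by have [?|?] := ltP b t; have [?|?] := ltP b s => ? ?; apply/andP; split; lra.
Qed.

Section Iteration.
Context {T : Type}.
Variables (Phi : (T -> R) -> T -> R) (y0 : T -> R) (C : R).
Hypothesis C0 : 0 < C.
Hypothesis PhiB : forall y i, `|Phi y i| <= C.
Hypothesis PhiL : forall (d : R) y z, (forall i, `|y i - z i| <= d) ->
  forall i, `|Phi y i - Phi z i| <= C * d.

Let e := (2 * C)^-1.
Let e0 : 0 < e. Proof. by rewrite invr_gt0 mulr_gt0. Qed.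
Let Ce : C * e = 2^-1.
Proof. by rewrite /e invfM mulrCA divff ?mulr1// gt_eqF. Qed.

Let lip (y : T -> R -> R) := forall i s t, `|s| <= e -> `|t| <= e ->
  `|y i t - y i s| <= C * `|t - s|.
Let succ (y z : T -> R -> R) := forall i, z i 0 = y0 i /\
  forall t : R, `|t| <= e -> is_derive t 1 (z i) (Phi (fun j => y j t) i).

Let succ_exists y : lip y -> exists z, succ y z.
Proof.
move=> ly.
suff /choice[z hz] : forall i, exists z : R -> R, z 0 = y0 i /\
    forall t : R, `|t| <= e -> is_derive t 1 z (Phi (fun j => y j t) i).
  by exists z.
move=> i.
have Ne : - e <= e by rewrite (le_trans _ (ltW e0))// oppr_le0 ltW.
(* with truncated time, the right-hand side is Lipschitz on the whole line *)
pose f t := Phi (fun j => y j (clamp (- e) e t)) i.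
have cf : continuous f.
  apply: (@lipschitz_continuous _ (C * C)) => s t; rewrite -mulrA; apply: PhiL => j.
  apply: (le_trans (ly _ _ _ _ _)); rewrite ?ler_norml ?clamp_in//.
  by rewrite ler_wpM2l ?(ltW C0)// clamp_lip.
have e2 : 0 < 2 * e by rewrite mulr_gt0.
have [F F0 dF] := @continuous_primitive R f (2 * e) e2 cf.
exists (fun t => y0 i + F t); split; first by rewrite F0 addr0.
move=> t te; have -> : Phi (y^~ t) i = f t by rewrite /f clamp_id// -ler_norml.
have te2 : `|t| < 2 * e by rewrite (le_lt_trans te)// ltr_pMl// ltrDl.
have := is_deriveD (is_derive_cst (y0 i) t 1) (dF t te2).
by rewrite add0r.
Qed.

Let succ_lip y z : succ y z -> lip z.
Proof.
move=> h i s t se te.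
apply: (@derive_bounded_lipschitz R (z i) (fun t => Phi (y^~ t) i) C e) => //.
by move=> u ue; exact: (h i).2.
Qed.

Let succ_contract y z y' z' d : succ y z -> succ y' z' ->
  (forall i t, `|t| <= e -> `|y i t - y' i t| <= d) ->
  forall i t, `|t| <= e -> `|z i t - z' i t| <= 2^-1 * d.
Proof.
move=> h h' yd i t te.
have d0 : 0 <= d by apply: le_trans (yd i 0 _) => //; rewrite normr0 ltW.
have := @derive_bounded_lipschitz R (fun t => z i t - z' i t)
  (fun t => Phi (y^~ t) i - Phi (y'^~ t) i) (C * d) e 0 t.
rewrite (h i).1 (h' i).1 subrr !subr0 => H.
apply: (le_trans (H _ _ _ _)) => //.
- by move=> u ue; apply: is_deriveB; [exact: (h i).2|exact: (h' i).2].
- by move=> u ue; apply: PhiL => j; exact: yd.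
- by rewrite normr0 ltW.
- by rewrite -Ce mulrAC ler_wpM2r// ler_wpM2l// ltW.
Qed.

(** Each step of the iteration halves the distance between two curves as long
    as the time is at most 1 / (2 C).  All iterates are C-Lipschitz, hence so is
    their limit.  The state space is T -> R for an arbitrary type T: its sup
    distance enters only through the hypothesis on Phi, which avoids any norm. *)
Lemma picard : exists2 y : T -> R -> R,
  (forall i, y i 0 = y0 i) &
  forall t : R, `|t| <= e ->
    forall i, is_derive t 1 (y i) (Phi (fun j => y j t) i).
Proof.
have [S HS] : exists S : (T -> R -> R) -> T -> R -> R,
    forall y, lip y -> succ y (S y).
  suff /choice[S hS] : forall y, exists z, lip y -> succ y z by exists S.
  move=> y; have [/succ_exists[z hz]|ny] := pselect (lip y); first by exists z.
  by exists y.
pose Y n := iter n S (fun i _ => y0 i).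
have lY n : lip (Y n).
  elim: n => [i s t _ _|n IH]; last exact: succ_lip (HS _ IH).
  by rewrite /= subrr normr0 mulr_ge0// ltW.
have sY n : succ (Y n) (Y n.+1) by apply: HS.
have dY n i t : `|t| <= e -> `|Y n.+1 i t - Y n i t| <= 2^-1 ^+ n.
  elim: n i t => [|n IH] i t te.
    have := succ_lip (sY 0%N) i (s := 0) (t := t).
    rewrite (sY 0%N i).1 normr0 subr0 => H; apply: (le_trans (H (ltW e0) te)).
    apply: (@le_trans _ _ (C * e)); first by rewrite ler_wpM2l// ltW.
    by rewrite Ce expr0; lra.
  by rewrite exprS; apply: succ_contract (sY _) (sY _) _ i t te.
have [y yY] : exists y : T -> R -> R, forall i t, `|t| <= e ->
    forall n, `|Y n i t - y i t| <= 2 * 2^-1 ^+ n.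
  have : forall it : T * R, exists l, `|it.2| <= e ->
      forall n, `|Y n it.1 it.2 - l| <= 2 * 2^-1 ^+ n.
    move=> [i t] /=; have [te|nte] := boolP (`|t| <= e); last by exists 0.
    have [l hl] := @geometric_cauchy_limit (fun n => Y n i t) (fun n => dY n i t te).
    by exists l.
  by move=> /choice[f hf]; exists (fun i t => f (i, t)) => i t; exact: (hf (i, t)).
have ly : lip y.
  move=> i s t se te; apply: (@le_geometric_eps _ _ 4) => n.
  have := lY n i s t se te; have := yY i s se n; have := yY i t te n.
  move: (2^-1 ^+ n) => q h1 h2 h3.
  have -> : y i t - y i s = (Y n i t - Y n i s) - (Y n i t - y i t)
    + (Y n i s - y i s) by ring.
  apply: (le_trans (ler_normD _ _)).
  have := ler_normB (Y n i t - Y n i s) (Y n i t - y i t).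
  by lra.
have sy := HS y ly.
have yS i t : `|t| <= e -> S y i t = y i t.
  move=> te; apply/eqP; rewrite -subr_eq0 -normr_le0.
  apply: (@le_geometric_eps _ _ 2) => n; rewrite add0r.
  have h2 : `|S y i t - Y n.+1 i t| <= 2^-1 * (2 * 2^-1 ^+ n).
    by apply: (succ_contract sy (sY n)) te => j u ue; rewrite distrC yY.
  have := yY i t te n.+1; rewrite exprS mulrA divff// mul1r => h1.
  rewrite mulrA mulVf// mul1r in h2.
  rewrite (_ : _ - _ = (S y i t - Y n.+1 i t) + (Y n.+1 i t - y i t)); last by ring.
  by rewrite (le_trans (ler_normD _ _))//; lra.
exists (S y) => [i|t te i]; first exact: (sy i).1.
rewrite (_ : (fun j => S y j t) = y^~ t); first exact: (sy i).2.
by apply/funext => j; rewrite yS.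
Qed.

End Iteration.
End Picard.

(** * The mean value theorem on boxes *)

Section Boxes.
Context {R : realType} {n : nat}.
Local Notation E := 'rV[R]_n.+1.
Local Notation e_ i := (delta_mx 0 i : E).

Definition box (x : E) (r : R) : set E := [set y | forall i, `|y 0 i - x 0 i| <= r].

Definition between (x y : E) : set E :=
  [set z | forall i, Num.min (x 0 i) (y 0 i) <= z 0 i <= Num.max (x 0 i) (y 0 i)].

Lemma box_nbhs (x : E) (A : set E) : nbhs x A -> exists2 r, 0 < r & box x r `<=` A.
Proof.
move=> /nbhs_ballP[r /= r0 rA]; exists (r / 2); first by rewrite divr_gt0.
move=> y hy; apply: rA; split => // i j.
rewrite /ball /= distrC (ord1 i) (le_lt_trans (hy j))// ltr_pdivrMr//.
by rewrite ltr_pMr// ltrDl.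
Qed.

Lemma box_nbhs_center (x : E) r : 0 < r -> nbhs x (box x r).
Proof.
move=> r0; apply/nbhs_ballP; exists r => // y [_ hy] i.
by have := hy 0 i; rewrite /ball /= distrC => /ltW.
Qed.

Lemma box_subset (x : E) r s : r <= s -> box x r `<=` box x s.
Proof. by move=> rs y hy i; rewrite (le_trans (hy i)). Qed.

Lemma box_center (x : E) r : 0 <= r -> box x r x.
Proof. by move=> r0 i; rewrite subrr normr0. Qed.

Lemma continuous_box (f : E -> R) (x : E) (eps : R) :
  {for x, continuous f} -> 0 < eps ->
  exists2 r, 0 < r & forall y, box x r y -> `|f y - f x| <= eps.
Proof.
move=> /cvgrPdist_le /(_ eps) H e0.
have [r r0 hr] := box_nbhs (H e0).
by exists r => // y /hr; rewrite distrC.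
Qed.

Lemma between_box (x0 x y : E) r : box x0 r x -> box x0 r y -> between x y `<=` box x0 r.
Proof.
move=> hx hy z hz i; have := hx i; have := hy i; have := hz i.
rewrite !ler_norml ge_min le_max.
by move=> /andP[/orP h1 /orP h2] /andP[? ?] /andP[? ?]; apply/andP; split; lra.
Qed.

Lemma is_derive_line (f : E -> R) (x v : E) (t : R) :
  derivable f (x + t *: v) v ->
  is_derive t 1 (fun s => f (x + s *: v)) ('D_v f (x + t *: v)).
Proof.
have eqf : (fun h : R => h^-1 *: (f (x + (h *: 1 + t) *: v) - f (x + t *: v))) =
  (fun h : R => h^-1 *: (f (h *: v + (x + t *: v)) - f (x + t *: v))).
  by apply/funext => h; rewrite [h *: 1]mulr1 scalerDl addrCA.
move=> df; split; first by rewrite /derivable eqf.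
by rewrite /derive eqf.
Qed.

Lemma coord_add_line (x : E) (i j : 'I_n.+1) (t : R) :
  (x + t *: e_ i) 0 j = x 0 j + t *+ (j == i).
Proof. by rewrite !mxE eqxx/= mulr_natr. Qed.

(** The coordinates of x are replaced one at a time by those of y, and each
    replacement is a mean value theorem along a coordinate axis. *)
Lemma box_mean_value (f : E -> R) (x y : E) :
  (forall z, between x y z -> forall i, derivable f z (e_ i)) ->
  exists2 xi : 'I_n.+1 -> E, forall i, between x y (xi i) &
    f y - f x = \sum_i partial i f (xi i) * (y 0 i - x 0 i).
Proof.
move=> df.
pose w k : E := \row_i (if (i < k)%N then y 0 i else x 0 i).
have w0 : w 0%N = x by apply/rowP => i; rewrite mxE.
have wn : w n.+1 = y by apply/rowP => i; rewrite mxE ltn_ord.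
have wS (i : 'I_n.+1) : w i.+1 = w i + (y 0 i - x 0 i) *: e_ i.
  apply/rowP => j; rewrite coord_add_line !mxE ltnS.
  have [->|ji] := eqVneq j i; first by rewrite leqnn ltnn mulr1n addrC subrK.
  by rewrite mulr0n addr0 [in RHS]ltn_neqAle (_ : _ != _ :> nat).
have step (i : 'I_n.+1) : exists2 z, between x y z &
    f (w i.+1) - f (w i) = partial i f z * (y 0 i - x 0 i).
  have bt (t : R) : Num.min 0 (y 0 i - x 0 i) <= t <= Num.max 0 (y 0 i - x 0 i) ->
      between x y (w i + t *: e_ i).
    rewrite ge_min le_max => /andP[/orP h1 /orP h2] j; rewrite coord_add_line mxE ge_min le_max.
    have [->|ji] := eqVneq j i.
      by rewrite ltnn mulr1n; apply/andP; split; apply/orP; lra.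
    by rewrite mulr0n addr0; case: ifP; rewrite !lexx ?orbT.
  have [|c /bt hc h] := @MVT_any R (fun t => f (w i + t *: e_ i))
     (fun t => partial i f (w i + t *: e_ i)) 0 (y 0 i - x 0 i).
    by move=> t /bt ht; apply: is_derive_line; exact: df.
  exists (w i + c *: e_ i) => //.
  by rewrite wS; move: h; rewrite scale0r addr0 subr0.
pose z i := sval (cid2 (step i)).
exists z => [i|]; first by rewrite /z; case: cid2.
rewrite -{1}wn -{1}w0 -(@telescope_sumr _ 0 n.+1 (fun k => f (w k)))//.
rewrite big_mkord; apply: eq_bigr => i _.
by rewrite /z; case: cid2.
Qed.

End Boxes.

(** * Smooth functions *)

Section ClassC.
Context {R : realType} {n : nat}.
Local Notation E := 'rV[R]_n.+1.
Local Notation e_ i := (delta_mx 0 i : E).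
Implicit Types (U : set E) (f g : E -> R) (x : E).

Lemma class_C_continuous k U f x : class_C k U f -> U x -> {for x, continuous f}.
Proof. by case: k => [|k] [h _]; exact: h. Qed.

Lemma class_C_derivable k U f x i : class_C k.+1 U f -> U x -> derivable f x (e_ i).
Proof. by move=> [_ /(_ i)[h _]]; exact: h. Qed.

Lemma class_C_partial k U f i : class_C k.+1 U f -> class_C k U (partial i f).
Proof. by move=> [_ /(_ i)[]]. Qed.

Lemma class_C_pred k U f : class_C k.+1 U f -> class_C k U f.
Proof.
elim: k f => [|k IH] f [cf df]; split=> // i; split; first exact: (df i).1.
exact: IH (df i).2.
Qed.

Lemma smooth_partial U f i : smooth U f -> smooth U (partial i f).
Proof. by move=> sf k; exact: class_C_partial (sf k.+1). Qed.

Lemma smooth_continuous U f x : smooth U f -> U x -> {for x, continuous f}.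
Proof. by move=> sf; exact: (class_C_continuous (sf 0%N)). Qed.

Lemma smooth_derivable U f x i : smooth U f -> U x -> derivable f x (e_ i).
Proof. by move=> sf; exact: class_C_derivable (sf 1%N). Qed.

Lemma open_near_eq U f g x : open U -> U x -> (forall y, U y -> f y = g y) ->
  \near x, f x = g x.
Proof.
move=> oU Ux fg; near=> y; apply: fg; near: y; exact: open_nbhs_nbhs.
Unshelve. all: by end_near. Qed.

Lemma partial_eq U f g x i : open U -> U x -> (forall y, U y -> f y = g y) ->
  partial i f x = partial i g x.
Proof. by move=> oU Ux fg; apply: near_eq_derive; exact: open_near_eq fg. Qed.

Lemma open_continuous_eq U f g x : open U -> U x -> (forall y, U y -> f y = g y) ->
  {for x, continuous f} -> {for x, continuous g}.
Proof.
move=> oU Ux fg cf.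
have h : g @ x `=>` f @ x.
  exact: (@near_eq_cvg _ _ (nbhs x) _ f g (open_near_eq oU Ux fg)).
apply: (cvg_trans h); have <- := fg x Ux; exact: cf.
Qed.

Lemma class_C_eq k U f g : open U -> (forall y, U y -> f y = g y) ->
  class_C k U f -> class_C k U g.
Proof.
move=> oU; elim: k f g => [|k IH] f g fg [cf df].
  by split => // x Ux; exact: open_continuous_eq oU Ux fg (cf x Ux).
split=> [x Ux|i]; first exact: open_continuous_eq oU Ux fg (cf x Ux).
split=> [x Ux|].
  by apply: near_eq_derivable ((df i).1 x Ux); exact: open_near_eq fg.
apply: IH (df i).2 => y Uy; exact: partial_eq fg.
Qed.

Lemma class_C_cst k U (a : R) : class_C k U (fun=> a).
Proof.
elim: k a => [|k IH] a; split=> //; first by move=> x _; exact: cst_continuous.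
  by move=> x _; exact: cst_continuous.
move=> i; split=> [x _|]; first exact: derivable_cst.
rewrite (_ : partial i _ = fun=> 0)//; apply/funext => x.
exact: (@derive_cst R E R a x (e_ i)).
Qed.

Lemma partialD f g x i : derivable f x (e_ i) -> derivable g x (e_ i) ->
  partial i (fun y => f y + g y) x = partial i f x + partial i g x.
Proof. exact: deriveD. Qed.

Lemma partialM f g x i : derivable f x (e_ i) -> derivable g x (e_ i) ->
  partial i (fun y => f y * g y) x = f x * partial i g x + g x * partial i f x.
Proof. exact: deriveM. Qed.

Lemma partialV f x i : f x != 0 -> derivable f x (e_ i) ->
  partial i (fun y => (f y)^-1) x = - (f x) ^- 2 * partial i f x.
Proof. by move=> f0 df; rewrite /partial deriveV. Qed.

Lemma class_CD k U f g : open U -> class_C k U f -> class_C k U g ->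
  class_C k U (fun x => f x + g x).
Proof.
move=> oU; elim: k f g => [|k IH] f g [cf df] [cg dg].
  by split=> // x Ux; apply: continuousD; [exact: cf|exact: cg].
split=> [x Ux|i]; first by apply: continuousD; [exact: cf|exact: cg].
split=> [x Ux|]; first by apply: derivableD; [exact: (df i).1|exact: (dg i).1].
apply: (@class_C_eq k U (fun y => partial i f y + partial i g y)) => //.
  by move=> y Uy; rewrite partialD//; [exact: (df i).1|exact: (dg i).1].
by apply: IH; [exact: (df i).2|exact: (dg i).2].
Qed.

Lemma class_CM k U f g : open U -> class_C k U f -> class_C k U g ->
  class_C k U (fun x => f x * g x).
Proof.
move=> oU; elim: k f g => [|k IH] f g Cf Cg; have [cf df] := Cf; have [cg dg] := Cg.
  by split=> // x Ux; apply: continuousM; [exact: cf|exact: cg].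
split=> [x Ux|i]; first by apply: continuousM; [exact: cf|exact: cg].
split=> [x Ux|]; first by apply: derivableM; [exact: (df i).1|exact: (dg i).1].
apply: (@class_C_eq k U (fun y => f y * partial i g y + g y * partial i f y)) => //.
  by move=> y Uy; rewrite partialM//; [exact: (df i).1|exact: (dg i).1].
have [Cf' Cg'] := (class_C_pred Cf, class_C_pred Cg).
by apply: class_CD => //; apply: IH => //; [exact: (dg i).2|exact: (df i).2].
Qed.

Lemma class_CV k U f : open U -> (forall x, U x -> f x != 0) -> class_C k U f ->
  class_C k U (fun x => (f x)^-1).
Proof.
move=> oU f0; elim: k => [|k IH] Cf; have [cf df] := Cf.
  by split=> // x Ux; apply: continuousV; [exact: f0|exact: cf].
split=> [x Ux|i]; first by apply: continuousV; [exact: f0|exact: cf].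
split=> [x Ux|]; first by apply: derivableV; [exact: f0|exact: (df i).1].
apply: (@class_C_eq k U (fun y => (-1 * ((f y)^-1 * (f y)^-1)) * partial i f y)) => //.
  move=> y Uy; rewrite partialV ?f0//; last exact: (df i).1.
  by rewrite mulN1r -invfM.
have Cf' := IH (class_C_pred Cf).
apply: class_CM => //; last exact: (df i).2.
by apply: class_CM => //; [exact: class_C_cst|exact: class_CM].
Qed.

Lemma smooth_cst U (a : R) : smooth U (fun=> a).
Proof. by move=> k; exact: class_C_cst. Qed.

Lemma smooth_eq U f g : open U -> (forall y, U y -> f y = g y) ->
  smooth U f -> smooth U g.
Proof. by move=> oU fg sf k; exact: class_C_eq (sf k). Qed.

Lemma smoothD U f g : open U -> smooth U f -> smooth U g -> smooth U (fun x => f x + g x).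
Proof. by move=> oU sf sg k; exact: class_CD. Qed.

Lemma smoothM U f g : open U -> smooth U f -> smooth U g -> smooth U (fun x => f x * g x).
Proof. by move=> oU sf sg k; exact: class_CM. Qed.

Lemma smoothN U f : open U -> smooth U f -> smooth U (fun x => - f x).
Proof.
move=> oU sf; apply: (@smooth_eq U (fun x => -1 * f x)) => //.
  by move=> y _; rewrite mulN1r.
by apply: smoothM => //; exact: smooth_cst.
Qed.

Lemma smoothB U f g : open U -> smooth U f -> smooth U g -> smooth U (fun x => f x - g x).
Proof. by move=> oU sf sg; apply: smoothD => //; exact: smoothN. Qed.

Lemma smoothV U f : open U -> (forall x, U x -> f x != 0) -> smooth U f ->
  smooth U (fun x => (f x)^-1).
Proof. by move=> oU f0 sf k; exact: class_CV. Qed.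

Lemma smooth_sum U (I : Type) (r : seq I) (P : pred I) (F : I -> E -> R) : open U ->
  (forall i, smooth U (F i)) -> smooth U (fun x => \sum_(i <- r | P i) F i x).
Proof.
move=> oU sF; elim: r => [|i r IH].
  by apply: smooth_eq (smooth_cst _ 0) => // y _; rewrite big_nil.
have [Pi|Pi] := boolP (P i).
  by apply: smooth_eq (smoothD oU (sF i) IH) => // y _; rewrite big_cons Pi.
by apply: smooth_eq IH => // y _; rewrite big_cons (negbTE Pi).
Qed.

Lemma smooth_prod U (I : Type) (r : seq I) (P : pred I) (F : I -> E -> R) : open U ->
  (forall i, smooth U (F i)) -> smooth U (fun x => \prod_(i <- r | P i) F i x).
Proof.
move=> oU sF; elim: r => [|i r IH].
  by apply: smooth_eq (smooth_cst _ 1) => // y _; rewrite big_nil.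
have [Pi|Pi] := boolP (P i).
  by apply: smooth_eq (smoothM oU (sF i) IH) => // y _; rewrite big_cons Pi.
by apply: smooth_eq IH => // y _; rewrite big_cons (negbTE Pi).
Qed.

Lemma smooth_det U m (A : E -> 'M[R]_m) : open U ->
  (forall i j, smooth U (fun x => A x i j)) -> smooth U (fun x => \det (A x)).
Proof.
move=> oU sA; rewrite /determinant; apply: smooth_sum => // s.
by apply: smoothM => //; [exact: smooth_cst | exact: smooth_prod].
Qed.

Lemma smooth_invmx U m (A : E -> 'M[R]_m) i j : open U ->
  (forall x, U x -> A x \in unitmx) ->
  (forall i j, smooth U (fun x => A x i j)) -> smooth U (fun x => invmx (A x) i j).
Proof.
move=> oU uA sA.
apply: (@smooth_eq U (fun x => (\det (A x))^-1 * cofactor (A x) j i)) => //.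
  by move=> x Ux; rewrite /invmx uA// !mxE.
apply: smoothM => //; first apply: smoothV => //.
- by move=> x /uA; rewrite unitmxE unitfE.
- exact: smooth_det.
rewrite /cofactor; apply: smoothM => //; first exact: smooth_cst.
by apply: smooth_det => // a b; apply: smooth_eq (sA _ _) => // y _; rewrite !mxE.
Qed.

End ClassC.

(** * Chain rule, second derivatives, local Lipschitz bounds *)

Section Calculus.
Context {R : realType} {n : nat}.
Local Notation E := 'rV[R]_n.+1.
Local Notation e_ i := (delta_mx 0 i : E).
Implicit Types (U : set E) (f g : E -> R) (x : E).

Let geminl (a b : R) : Num.min a b <= a. Proof. by rewrite ge_min lexx. Qed.
Let geminr (a b : R) : Num.min a b <= b. Proof. by rewrite ge_min lexx orbT. Qed.

Let dist_le_halves (p a b d : R) : `|p - a| <= d / 2 -> `|p - b| <= d / 2 -> `|b - a| <= d.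
Proof. by rewrite !ler_norml => /andP[? ?] /andP[? ?]; apply/andP; split; lra. Qed.

Lemma open_box U x : open U -> U x -> exists2 r, 0 < r & box x r `<=` U.
Proof. by move=> oU Ux; apply: box_nbhs; exact: open_nbhs_nbhs. Qed.

(** The increment of f along c is a combination of partial derivatives at points
    of the box spanned by c t and c (h + t), which tend to c t; so continuity of
    the partial derivatives is enough, and differentiability of f is bypassed. *)
Lemma class_C1_chain U f (c c' : R -> E) (t : R) : open U -> class_C 1 U f -> U (c t) ->
  (forall i, is_derive t 1 (fun s => c s 0 i) (c' t 0 i)) ->
  is_derive t 1 (fun s => f (c s)) (\sum_i partial i f (c t) * c' t 0 i).
Proof.
move=> oU Cf Uc dc.
have [r r0 rU] := open_box oU Uc.
have xiP (h : R) : exists xi : 'I_n.+1 -> E, box (c t) r (c (h + t)) ->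
    (forall i, between (c t) (c (h + t)) (xi i)) /\
    f (c (h + t)) - f (c t) = \sum_i partial i f (xi i) * (c (h + t) 0 i - c t 0 i).
  have [hb|nb] := pselect (box (c t) r (c (h + t))); last by exists (fun=> 0).
  have [z /(between_box (box_center _ (ltW r0)) hb)/rU Uz i|xi hx hxi] :=
    @box_mean_value R n f (c t) (c (h + t)).
    exact: class_C_derivable Cf Uz.
  by exists xi.
have [xi hxi] := choice xiP.
have ccont i : (fun h : R => c (h + t) 0 i) @ 0 --> c t 0 i.
  have := differentiable_continuous ((derivable1_diffP _ _).1 (@ex_derive _ _ _ _ _ _ _ (dc i))).
  rewrite /continuous_at => H.
  have sh : (fun h : R => h + t) @ 0 --> t.
    by rewrite -[X in _ --> X]add0r; apply: cvgD; [exact: cvg_id|exact: cvg_cst].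
  exact: (cvg_comp _ _ sh H).
have cbox s : 0 < s -> \forall h \near (0 : R)^', box (c t) s (c (h + t)).
  move=> s0; apply: nbhs_dnbhs.
  have /filter_forall : forall i, \forall h \near (0 : R), `|c (h + t) 0 i - c t 0 i| <= s.
    move=> i; have /cvgrPdist_le/(_ s s0) := ccont i.
    by apply: filterS => h; rewrite distrC.
  by apply: filterS.
have xicvg i : (fun h : R => partial i f (xi h i)) @ 0^' --> partial i f (c t).
  apply/cvgrPdist_le => eps eps0.
  have [s s0 hs] := continuous_box (class_C_continuous (class_C_partial i Cf) Uc) eps0.
  have m0 : 0 < Num.min r s by rewrite lt_min r0.
  apply: filterS (cbox _ m0) => h hb.
  have hr := box_subset (geminl r s) hb.
  rewrite distrC; apply: hs; apply: (box_subset (geminr r s)).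
  exact: (between_box (box_center _ (ltW m0)) hb ((hxi h hr).1 i)).
have cvgq : (fun h : R => h^-1 *: (f (c (h *: 1 + t)) - f (c t))) @ 0^' -->
    \sum_i partial i f (c t) * c' t 0 i.
  have e : \forall h \near (0 : R)^',
      \sum_i partial i f (xi h i) * (h^-1 *: (c (h *: 1 + t) 0 i - c t 0 i)) =
      h^-1 *: (f (c (h *: 1 + t)) - f (c t)).
    apply: filterS (cbox _ r0) => h hb; rewrite [h *: 1]mulr1 (hxi h hb).2 scaler_sumr.
    by apply: eq_bigr => i _; rewrite [LHS]mulrCA.
  apply: (cvg_trans (near_eq_cvg e)).
  apply: cvg_big => [|i _]; first exact: add_continuous.
  apply: cvgM => //.
  have [di <-] := dc i; exact: di.
split; first by apply/cvg_ex; eexists; exact: cvgq.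
exact: cvg_lim cvgq.
Qed.

(** The left-hand side is symmetric in i and j; [partialC] is the comparison of
    the two expressions so obtained, as h tends to 0. *)
Lemma second_difference f x i j (h : R) :
  (forall z, box x (2 * `|h|) z -> derivable f z (e_ i) /\ derivable (partial i f) z (e_ j)) ->
  exists2 xi, box x (2 * `|h|) xi &
    f (x + h *: e_ i + h *: e_ j) - f (x + h *: e_ i) - f (x + h *: e_ j) + f x =
    partial j (partial i f) xi * h * h.
Proof.
move=> df.
have inb (s u : R) : Num.min 0 h <= s <= Num.max 0 h -> Num.min 0 h <= u <= Num.max 0 h ->
    box x (2 * `|h|) (x + s *: e_ i + u *: e_ j).
  move=> hs hu k; rewrite !coord_add_line addrAC [X in X + _]addrAC subrr add0r.
  have hb (v : R) b : Num.min 0 h <= v <= Num.max 0 h -> `|v *+ (b : bool)| <= `|h|.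
    case: b => [|_]; last by rewrite mulr0n normr0.
    rewrite mulr1n ge_min le_max => /andP[/orP h1 /orP h2].
    have [h0|h0] := leP 0 h.
      by rewrite (ger0_norm h0) ler_norml; apply/andP; split; lra.
    by rewrite (ltr0_norm h0) ler_norml; apply/andP; split; lra.
  by rewrite (le_trans (ler_normD _ _))// mulr_natl mulr2n lerD// hb.
have h0 : Num.min 0 h <= 0 <= Num.max 0 h by rewrite ge_min le_max lexx.
have hh : Num.min 0 h <= h <= Num.max 0 h by rewrite ge_min le_max lexx !orbT.
have [|s hs e1] := @MVT_any R
   (fun s => f (x + h *: e_ j + s *: e_ i) - f (x + s *: e_ i))
   (fun s => partial i f (x + h *: e_ j + s *: e_ i) - partial i f (x + s *: e_ i)) 0 h.
  move=> s hs; apply: is_deriveB; apply: is_derive_line.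
    by rewrite addrAC; exact: (df _ (inb s h hs hh)).1.
  by have := (df _ (inb s 0 hs h0)).1; rewrite scale0r addr0.
have [|u hu e2] := @MVT_any R
   (fun u => partial i f (x + s *: e_ i + u *: e_ j))
   (fun u => partial j (partial i f) (x + s *: e_ i + u *: e_ j)) 0 h.
  by move=> u hu; apply: is_derive_line; exact: (df _ (inb s u hs hu)).2.
exists (x + s *: e_ i + u *: e_ j); first exact: inb.
rewrite scale0r !addr0 subr0 in e2; rewrite scale0r !addr0 subr0 in e1.
by rewrite -e2 [x + s *: _ + _]addrAC -e1 [x + h *: e_ i + _]addrAC; ring.
Qed.

Lemma partialC U f x i j : open U -> smooth U f -> U x ->
  partial i (partial j f) x = partial j (partial i f) x.
Proof.
move=> oU sf Ux; apply/eqP; rewrite -subr_eq0 -normr_le0; apply/ler_addgt0Pr => eps eps0.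
have [r r0 rU] := open_box oU Ux.
have e20 : 0 < eps / 2 by rewrite divr_gt0.
have [r1 r10 hr1] := continuous_box
  (smooth_continuous (smooth_partial i (smooth_partial j sf)) Ux) e20.
have [r2 r20 hr2] := continuous_box
  (smooth_continuous (smooth_partial j (smooth_partial i sf)) Ux) e20.
pose h := Num.min r (Num.min r1 r2) / 2.
have h0 : 0 < h by rewrite divr_gt0// !lt_min r0 r10.
have e2h : 2 * `|h| = Num.min r (Num.min r1 r2) by rewrite gtr0_norm// mulrC divfK.
have hb z : box x (2 * `|h|) z -> U z.
  by rewrite e2h => hz; apply/rU/(box_subset _ hz); rewrite ge_min lexx.
have [|xi xib e1] := @second_difference f x i j h.
  move=> z /hb Uz; split; apply: smooth_derivable Uz => //; exact: smooth_partial.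
have [|eta etab e2] := @second_difference f x j i h.
  move=> z /hb Uz; split; apply: smooth_derivable Uz => //; exact: smooth_partial.
have e : partial j (partial i f) xi = partial i (partial j f) eta.
  have hn : h != 0 by rewrite gt_eqF.
  suff : partial j (partial i f) xi * h * h = partial i (partial j f) eta * h * h.
    by move/(mulIf hn)/(mulIf hn).
  apply: (etrans (esym e1)); apply: (etrans _ e2).
  by rewrite [x + h *: e_ j + _]addrAC [X in X + _ = _]addrAC.
rewrite e2h in xib etab.
have h1 : `|partial i (partial j f) eta - partial i (partial j f) x| <= eps / 2.
  by apply: hr1; apply: (box_subset _ etab); rewrite !ge_min lexx !orbT.
have h2 : `|partial j (partial i f) xi - partial j (partial i f) x| <= eps / 2.
  by apply: hr2; apply: (box_subset _ xib); rewrite !ge_min lexx !orbT.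
by rewrite add0r; rewrite e in h2; exact: dist_le_halves h2 h1.
Qed.

(** On a box where each partial derivative moves by at most 1, the sum of their
    bounds at the centre is a Lipschitz constant. *)
Lemma class_C1_locally_lipschitz U f x : open U -> class_C 1 U f -> U x ->
  exists2 r, 0 < r & exists2 C, 0 <= C &
    (forall y, box x r y -> `|f y| <= C) /\
    forall (d : R) y z, box x r y -> box x r z -> (forall i, `|y 0 i - z 0 i| <= d) ->
      `|f y - f z| <= C * d.
Proof.
move=> oU Cf Ux.
have [r0 r00 rU] := open_box oU Ux.
have [r1 r10 hr1] := continuous_box (class_C_continuous Cf Ux) (@ltr01 R).
have [rp hrp] : exists rp : 'I_n.+1 -> R, forall i, 0 < rp i /\
    forall y, box x (rp i) y -> `|partial i f y - partial i f x| <= 1.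
  suff /choice[rp hrp] : forall i, exists r, 0 < r /\
    forall y, box x r y -> `|partial i f y - partial i f x| <= 1 by exists rp.
  move=> i; have [s s0 hs] := continuous_box
    (class_C_continuous (class_C_partial i Cf) Ux) (@ltr01 R).
  by exists s.
pose r := \big[Num.min/Num.min r0 r1]_i rp i.
have rr : r <= Num.min r0 r1 by exact: bigmin_le_id.
have ri i : r <= rp i by exact: bigmin_le_cond.
exists r; first by apply: lt_bigmin => [|i _]; [rewrite lt_min r00|case: (hrp i)].
pose C := 1 + `|f x| + \sum_i (1 + `|partial i f x|).
have S0 : 0 <= \sum_i (1 + `|partial i f x|) by apply: sumr_ge0 => i _; rewrite addr_ge0.
exists C; first by rewrite !addr_ge0.
split=> [y hy|d y z hy hz hd].
  have h1 := hr1 y (box_subset (le_trans rr (geminr _ _)) hy).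
  have : `|f y| <= `|f y - f x| + `|f x| by rewrite -{1}(subrK (f x) (f y)) ler_normD.
  by rewrite /C; lra.
have d0 : 0 <= d by apply: le_trans (hd ord0).
have [w hw i|xi hx ->] := @box_mean_value R n f z y.
  apply: class_C_derivable Cf _; apply: rU; apply: box_subset (between_box hz hy hw).
  exact: le_trans rr (geminl _ _).
rewrite (le_trans (ler_norm_sum _ _ _))//.
apply: (@le_trans _ _ ((\sum_i (1 + `|partial i f x|)) * d)).
  rewrite mulr_suml; apply: ler_sum => i _; rewrite normrM ler_pM//.
  have h1 := (hrp i).2 _ (box_subset (ri i) (between_box hz hy (hx i))).
  have : `|partial i f (xi i)| <= `|partial i f (xi i) - partial i f x| + `|partial i f x|.
    by rewrite -{1}(subrK (partial i f x) (partial i f (xi i))) ler_normD.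
  by lra.
by rewrite ler_wpM2r// /C lerDr addr_ge0.
Qed.

(** By the mean value theorem f is locally constant, so its level sets are open
    and closed in U. *)
Lemma partial0_constant U f : open U -> connected U ->
  (forall x i, U x -> derivable f x (e_ i)) ->
  (forall x i, U x -> partial i f x = 0) ->
  forall x y, U x -> U y -> f x = f y.
Proof.
move=> oU cU df pf x y Ux Uy.
have loc z : U z -> exists2 r, 0 < r & forall w, box z r w -> U w /\ f w = f z.
  move=> Uz; have [r r0 rU] := open_box oU Uz; exists r => // w hw; split; first exact: rU.
  have bU v : between z w v -> U v.
    by move=> /(between_box (box_center _ (ltW r0)) hw)/rU.
  have [v /bU Uv i|xi hx e] := @box_mean_value R n f z w; first exact: df.
  apply/eqP; rewrite -subr_eq0 e big1// => i _.
  by rewrite pf ?mul0r//; exact: bU.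
have : U `&` [set z | f z = f x] = U.
  apply: cU; first by exists x.
  - exists (U `&` [set z | f z = f x]); last by rewrite setIA setIid.
    rewrite openE => z [Uz fz]; have [r r0 hr] := loc z Uz.
    apply: filterS (box_nbhs_center z r0) => w /hr[Uw fw]; split=> //=.
    by rewrite fw.
  - exists (~` (U `&` [set z | f z <> f x])).
      apply: open_closedC; rewrite openE => z [Uz fz]; have [r r0 hr] := loc z Uz.
      apply: filterS (box_nbhs_center z r0) => w /hr[Uw fw]; split=> //=.
      by rewrite fw.
    apply/seteqP; split=> [z [Uz fz]|z [Uz hz]]; split=> //=; first by move=> [].
    by apply: contrapT => fz; apply: hz.
by move=> /seteqP[_ /(_ y Uy)][_ /= ->].
Qed.

End Calculus.

(** * Existence of geodesics *)

Section LipschitzBounded.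
Context {R : realType} {T : Type}.
Implicit Types h k : (T -> R) -> R.

(** Boundedness is included because it makes the class stable under products. *)
Definition lip_bounded h := exists C : R, [/\ 0 <= C, forall y, `|h y| <= C &
  forall (d : R) y z, (forall i, `|y i - z i| <= d) -> `|h y - h z| <= C * d].

Lemma lip_boundedN h : lip_bounded h -> lip_bounded (fun y => - h y).
Proof.
move=> [C [C0 hB hL]]; exists C; split=> // [y|d y z yz]; first by rewrite normrN.
by rewrite -opprD normrN hL.
Qed.

Lemma lip_boundedD h k : lip_bounded h -> lip_bounded k -> lip_bounded (fun y => h y + k y).
Proof.
move=> [C [C0 hB hL]] [D [D0 kB kL]]; exists (C + D); split.
- by rewrite addr_ge0.
- by move=> y; rewrite (le_trans (ler_normD _ _))// lerD.
- move=> d y z yz.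
  rewrite (_ : _ - _ = (h y - h z) + (k y - k z)); last by ring.
  by rewrite (le_trans (ler_normD _ _))// mulrDl lerD// ?hL ?kL.
Qed.

Lemma lip_boundedM h k : lip_bounded h -> lip_bounded k -> lip_bounded (fun y => h y * k y).
Proof.
move=> [C [C0 hB hL]] [D [D0 kB kL]].
exists (C * D + (C * D + D * C)); split.
- by rewrite !addr_ge0// mulr_ge0.
- move=> y; rewrite normrM (@le_trans _ _ (C * D))// ?ler_pM// lerDl.
  by rewrite addr_ge0// mulr_ge0.
- move=> d y z yz.
  rewrite (_ : _ - _ = h y * (k y - k z) + k z * (h y - h z)); last by ring.
  rewrite (le_trans (ler_normD _ _))// !normrM.
  have d0 : 0 <= C * d by apply: le_trans (hL d y z yz).
  have d1 : 0 <= D * d by apply: le_trans (kL d y z yz).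
  have := ler_pM (normr_ge0 _) (normr_ge0 _) (hB y) (kL d y z yz).
  have := ler_pM (normr_ge0 _) (normr_ge0 _) (kB z) (hL d y z yz).
  have : 0 <= C * D * d by rewrite -mulrA mulr_ge0.
  by rewrite !mulrDl !mulrA; lra.
Qed.

Lemma lip_bounded0 : lip_bounded (fun=> 0).
Proof. by exists 0; split=> // [y|d y z _]; rewrite ?subrr ?normr0 ?mul0r. Qed.

Lemma lip_bounded_sum (I : Type) (r : seq I) (H : I -> (T -> R) -> R) :
  (forall i, lip_bounded (H i)) -> lip_bounded (fun y => \sum_(i <- r) H i y).
Proof.
move=> hH; elim: r => [|i r IH].
  rewrite (_ : (fun y => _) = fun=> 0); first exact: lip_bounded0.
  by apply/funext => y; rewrite big_nil.
rewrite (_ : (fun y => _) = fun y => H i y + \sum_(j <- r) H j y).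
  exact: lip_boundedD.
by apply/funext => y; rewrite big_cons.
Qed.

Lemma lip_bounded_clamp (i : T) (a b : R) : a <= b -> lip_bounded (fun y => clamp a b (y i)).
Proof.
move=> ab; exists (`|a| + `|b| + 1); split; first by rewrite !addr_ge0.
  move=> y; have /andP[h1 h2] := clamp_in (y i) ab.
  have := ler_norm b; have := ler_norm (- a); rewrite normrN => ? ?.
  have := normr_ge0 a; have := normr_ge0 b => ? ?.
  by rewrite ler_norml; apply/andP; split; lra.
move=> d y z yz; have d0 : 0 <= d by apply: le_trans (yz i).
rewrite (le_trans (clamp_lip _ _ _ _))// (le_trans (yz i))// ler_peMl// lerDr.
by rewrite addr_ge0.
Qed.

End LipschitzBounded.

Section GeodesicExistence.
Context {R : realType} {n : nat}.
Local Notation E := 'rV[R]_n.+1.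
Local Notation I := 'I_n.+1.

(** The second derivative of a geodesic at x with velocity v. *)
Definition geodesic_acc (g : E -> 'M[R]_n.+1) (x v : E) (k : I) : R :=
  - \sum_i \sum_j christoffel g k i j x * v 0 i * v 0 j.

(** The geodesic equation is a first-order equation for the pair of position
    (indices (false, i)) and velocity (indices (true, i)).  Truncating the
    positions to a box inside U and the velocities to a neighbourhood of v makes
    its field bounded and Lipschitz; the solution does not feel the truncation
    for small times. *)
Lemma geodesic_exists (U : set E) (g : E -> 'M[R]_n.+1) (x v : E) : open U ->
  (forall k i j, class_C 1 U (christoffel g k i j)) -> U x ->
  exists (e : R) (c c' : R -> E), [/\ 0 < e, c 0 = x, c' 0 = v &
    forall t : R, `|t| < e -> [/\ U (c t),
      forall i, is_derive t 1 (fun s => c s 0 i) (c' t 0 i) &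
      forall k, is_derive t 1 (fun s => c' s 0 k) (geodesic_acc g (c t) (c' t) k)]].
Proof.
move=> oU CG Ux.
pose GLip (r C : R) (f : E -> R) := (forall y, box x r y -> `|f y| <= C) /\
  (forall (d : R) y z, box x r y -> box x r z -> (forall i, `|y 0 i - z 0 i| <= d) ->
      `|f y - f z| <= C * d).
have [rC hrC] : exists rC : I * I * I -> R * R, forall a, [/\ 0 < (rC a).1, 0 <= (rC a).2 &
    GLip (rC a).1 (rC a).2 (christoffel g a.1.1 a.1.2 a.2)].
  suff /choice[rC hrC] : forall a : I * I * I, exists rC : R * R,
    [/\ 0 < rC.1, 0 <= rC.2 & GLip rC.1 rC.2 (christoffel g a.1.1 a.1.2 a.2)] by exists rC.
  move=> a; have [r r0 [C C0 hC]] := class_C1_locally_lipschitz oU (CG a.1.1 a.1.2 a.2) Ux.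
  by exists (r, C).
have [r0 r00 r0U] := open_box oU Ux.
pose r := \big[Num.min/r0]_a (rC a).1.
have rpos : 0 < r by apply: lt_bigmin => // a _; have [] := hrC a.
have rr0 : r <= r0 by exact: bigmin_le_id.
have ra a : r <= (rC a).1 by exact: bigmin_le_cond.
pose T := (bool * I)%type.
pose X (y : T -> R) : E := \row_i clamp (x 0 i - r) (x 0 i + r) (y (false, i)).
pose W (y : T -> R) (i : I) := clamp (v 0 i - 1) (v 0 i + 1) (y (true, i)).
pose Phi (y : T -> R) (a : T) : R := if a.1
  then - \sum_i \sum_j christoffel g a.2 i j (X y) * W y i * W y j else W y a.2.
have xr i : x 0 i - r <= x 0 i + r by lra.
have Xbox y : box x r (X y).
  move=> i; rewrite mxE ler_norml.
  by have /andP[h1 h2] := clamp_in (y (false, i)) (xr i); apply/andP; split; lra.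
have LW i : lip_bounded (W^~ i) by apply: lip_bounded_clamp; lra.
have LG k i j : lip_bounded (fun y => christoffel g k i j (X y)).
  have [_ C0 [hB hL]] := hrC (k, i, j).
  have hX y : box x (rC (k, i, j)).1 (X y) by apply: (box_subset (ra _)).
  exists (rC (k, i, j)).2; split=> // [y|d y z yz]; first exact: hB.
  apply: hL => // m; rewrite !mxE; exact: le_trans (clamp_lip _ _ _ _) (yz _).
have LPhi a : lip_bounded (Phi^~ a).
  rewrite /Phi; case: a => -[] k /=; last exact: LW.
  apply: lip_boundedN; do 2! [apply: lip_bounded_sum => ?].
  by do 2! [apply: lip_boundedM => //].
have [CC hCC] := choice LPhi.
pose C := 1 + \sum_a CC a.
have CCC a : CC a <= C.
  rewrite /C (bigD1 a)//= addrCA lerDl addr_ge0// sumr_ge0// => b _.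
  by have [] := hCC b.
have Cpos : 0 < C by rewrite ltr_wpDr// sumr_ge0// => b _; have [] := hCC b.
pose y0 (a : T) : R := if a.1 then v 0 a.2 else x 0 a.2.
have PB y i : `|Phi y i| <= C by have [_ h _] := hCC i; exact: le_trans (h y) (CCC i).
have [d y z yz i|y yy0 dy] := @picard R T Phi y0 C Cpos PB.
  have [_ _ h] := hCC i; apply: le_trans (h d y z yz) _.
  by rewrite ler_wpM2r//; apply: le_trans (yz i).
pose e0 := (2 * C)^-1; have e00 : 0 < e0 by rewrite invr_gt0 mulr_gt0.
pose e := Num.min e0 (Num.min r 1 / C).
have epos : 0 < e by rewrite lt_min e00 divr_gt0// lt_min rpos ltr01.
have ye (t : R) a : `|t| < e -> `|y a t - y0 a| <= Num.min r 1.
  rewrite lt_min => /andP[te0 te1].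
  have := @derive_bounded_lipschitz R (y a) (fun t => Phi (fun j => y j t) a) C e0 0 t.
  rewrite yy0 subr0 normr0 => H; apply: (le_trans (H _ _ _ _)) => //.
  - by move=> u ue; exact: dy.
  - exact: ltW.
  - exact: ltW.
  - by rewrite -ler_pdivlMl// mulrC ltW.
pose c t : E := \row_i y (false, i) t; pose c' t : E := \row_i y (true, i) t.
exists e, c, c'; split=> //.
- by apply/rowP => i; rewrite mxE yy0.
- by apply/rowP => i; rewrite mxE yy0.
move=> t te.
have Xc : X (fun a => y a t) = c t.
  apply/rowP => i; rewrite !mxE clamp_id//.
  have := ye t (false, i) te; rewrite le_min => /andP[+ _].
  by rewrite ler_norml /y0/= => /andP[? ?]; apply/andP; split; lra.
have Wc i : W (fun a => y a t) i = c' t 0 i.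
  rewrite /W mxE clamp_id//.
  have := ye t (true, i) te; rewrite le_min => /andP[_ +].
  by rewrite ler_norml /y0/= => /andP[? ?]; apply/andP; split; lra.
have te0 : `|t| <= e0 by move: te; rewrite lt_min => /andP[/ltW].
split.
- by rewrite -Xc; apply/r0U/(box_subset rr0).
- move=> i; rewrite -Wc.
  rewrite (_ : (fun s => c s 0 i) = y (false, i)); last by apply/funext => s; rewrite mxE.
  exact: (dy t te0 (false, i)).
- move=> k.
  rewrite (_ : (fun s => c' s 0 k) = y (true, k)); last by apply/funext => s; rewrite mxE.
  have := dy t te0 (true, k); rewrite /Phi /= /geodesic_acc Xc.
  by under eq_bigr do under eq_bigr do rewrite !Wc.
Qed.

End GeodesicExistence.

(** * Curves on circles *)

Section Dot.
Context {R : realType} {n : nat}.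
Implicit Types u v w : 'rV[R]_n.+1.

Definition dot u v : R := \sum_i u 0 i * v 0 i.

Lemma dotC u v : dot u v = dot v u.
Proof. by apply: eq_bigr => i _; rewrite mulrC. Qed.

Lemma dotDr u v w : dot u (v + w) = dot u v + dot u w.
Proof. by rewrite /dot -big_split; apply: eq_bigr => i _; rewrite mxE mulrDr. Qed.

Lemma dotZr a u v : dot u (a *: v) = a * dot u v.
Proof. by rewrite /dot mulr_sumr; apply: eq_bigr => i _; rewrite mxE mulrCA. Qed.

Lemma dotBr u v w : dot u (v - w) = dot u v - dot u w.
Proof. by rewrite -scaleN1r dotDr dotZr mulN1r. Qed.

Lemma bform1E u v : bform 1%:M u v = dot u v.
Proof. by rewrite /bform mulmx1 mxE; apply: eq_bigr => i _; rewrite mxE. Qed.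

Lemma dotv0 u : dot u 0 = 0.
Proof. by rewrite /dot big1// => i _; rewrite mxE mulr0. Qed.

Lemma dot_eq0 u : dot u u = 0 -> u = 0.
Proof.
move=> /eqP; rewrite /dot psumr_eq0 => [/allP uu|i _]; last by rewrite -expr2 sqr_ge0.
apply/rowP => i; have := uu i (mem_index_enum i).
by rewrite mulf_eq0 orbb mxE => /eqP.
Qed.

End Dot.

Section Derivatives.
Context {R : realType}.

Lemma is_derive_sumf (n : nat) (h : 'I_n -> R -> R) (dh : 'I_n -> R) (t : R) :
  (forall i, is_derive t 1 (h i) (dh i)) ->
  is_derive t 1 (fun s => \sum_i h i s) (\sum_i dh i).
Proof.
move=> dhi; have := is_derive_sum dhi.
by rewrite (_ : \sum_(i < n) h i = fun s => \sum_i h i s)//; apply/funext => s; rewrite fct_sumE.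
Qed.

Lemma is_deriveMf (f g : R -> R) (df dg t : R) : is_derive t 1 f df -> is_derive t 1 g dg ->
  is_derive t 1 (fun s => f s * g s) (f t * dg + df * g t).
Proof. by move=> hf hg; have := is_deriveM hf hg; rewrite /GRing.scale /= [g t * df]mulrC. Qed.

Lemma near_ball0 (e t : R) (P : R -> Prop) : `|t| < e -> (forall s, `|s| < e -> P s) ->
  \forall s \near t, P s.
Proof.
move=> te hP; apply/nbhs_ballP; exists (e - `|t|); first by rewrite /= subr_gt0.
move=> s; rewrite /ball /= => h; apply: hP.
by have := ler_normD t (s - t); rewrite distrC addrC subrK; lra.
Qed.

Lemma derive_constant (f : R -> R) (k e t d : R) :
  (forall s, `|s| < e -> f s = k) -> `|t| < e -> is_derive t 1 f d -> d = 0.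
Proof.
move=> fk te [_ <-].
rewrite (@near_eq_derive _ _ _ _ (cst k)); first exact: derive_cst.
exact: near_ball0 te fk.
Qed.

End Derivatives.

Section CurvesOnCircles.
Context {R : realType} {n : nat}.
Local Notation E := 'rV[R]_n.+1.
Variables (e : R) (c0 c1 c2 : R -> E) (b : E).
Hypothesis e0 : 0 < e.
Hypothesis d0 : forall (t : R) i, `|t| < e -> is_derive t 1 (fun s => c0 s 0 i) (c1 t 0 i).
Hypothesis d1 : forall (t : R) i, `|t| < e -> is_derive t 1 (fun s => c1 s 0 i) (c2 t 0 i).
Hypothesis d2 : forall i, is_derive (0 : R) 1 (fun s => c2 s 0 i) (b 0 i).

Let zlt : `|0 : R| < e. Proof. by rewrite normr0. Qed.

Let subspace_derivative m (P : 'M[R]_(m, n.+1)) (o : E) (c c' : R -> E) (t : R) : `|t| < e ->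
  (forall s, `|s| < e -> (c s - o <= P)%MS) ->
  (forall i, is_derive t 1 (fun s => c s 0 i) (c' t 0 i)) -> (c' t <= P)%MS.
Proof.
move=> te cP dc; rewrite submxE; apply/eqP/rowP => j; rewrite [RHS]mxE.
apply: (@derive_constant R (fun s => ((c s - o) *m cokermx P) 0 j) 0 e t) => //.
  by move=> s /cP; rewrite submxE => /eqP->; rewrite mxE.
rewrite (_ : (fun s => _) = fun s => \sum_i (c s 0 i - o 0 i) * cokermx P i j); last first.
  by apply/funext => s; rewrite mxE; apply: eq_bigr => i _; rewrite !mxE.
rewrite mxE; apply: is_derive_sumf => i.
have := is_deriveMf (is_deriveB (dc i) (is_derive_cst (o 0 i) t 1))
  (is_derive_cst (cokermx P i j) t 1).
by rewrite mulr0 add0r subr0.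
Qed.

Let dot_derivative (c c' d d' : R -> E) (t : R) :
  (forall i, is_derive t 1 (fun s => c s 0 i) (c' t 0 i)) ->
  (forall i, is_derive t 1 (fun s => d s 0 i) (d' t 0 i)) ->
  is_derive t 1 (fun s => dot (c s) (d s)) (dot (c t) (d' t) + dot (c' t) (d t)).
Proof.
move=> dc dd; rewrite /dot -big_split; apply: is_derive_sumf => i; exact: is_deriveMf.
Qed.

Let Z := dot (c1 0) (c1 0) *: b - 3 * dot (c2 0) (c1 0) *: c2 0.

Let all_in_plane m (P : 'M[R]_(m, n.+1)) (o : E) :
  (forall s, `|s| < e -> (c0 s - o <= P)%MS) ->
  [/\ (c1 0 <= P)%MS, (c2 0 <= P)%MS & (b <= P)%MS].
Proof.
move=> h0.
have h1 t : `|t| < e -> (c1 t <= P)%MS.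
  by move=> te; apply: (@subspace_derivative m P o c0 c1 t te h0) => i; exact: d0.
have h2 t : `|t| < e -> (c2 t <= P)%MS.
  move=> te; apply: (@subspace_derivative m P 0 c1 c2 t te) => [s se|i]; last exact: d1.
  by rewrite subr0 h1.
split; [exact: h1|exact: h2|].
apply: (@subspace_derivative m P 0 c2 (fun=> b) 0 zlt) => s se.
by rewrite subr0 h2.
Qed.

Let Z_in_plane m (P : 'M[R]_(m, n.+1)) (o : E) :
  (forall s, `|s| < e -> (c0 s - o <= P)%MS) -> (Z <= P)%MS.
Proof.
move=> /all_in_plane[_ h2 h3]; rewrite /Z -scaleNr.
by apply: addmx_sub; exact: scalemx_sub.
Qed.

(** For a round circle with centre c and q = c0 - c, differentiating <q, q> = r^2
    three times gives <q, c1> = 0, <q, c2> = - |c1|^2 and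
    <q, b> = - 3 <c2, c1>.  The combination below is the one orthogonal to q.
    It also lies in the plane of the circle, where the orthogonal of q is
    spanned by c1, unless c1 = 0 and the combination vanishes.  On a straight line
    all derivatives are parallel. *)
Lemma circle_third_derivative C : circle C -> (forall t, `|t| < e -> C (c0 t)) ->
  exists k, dot (c1 0) (c1 0) *: b - 3 * dot (c2 0) (c1 0) *: c2 0 = k *: c1 0.
Proof.
rewrite -/Z => circC cC.
have [v0|v0] := eqVneq (c1 0) 0.
  by exists 0; rewrite /Z v0 !dotv0 mulr0 !scale0r subr0.
case: circC => [[ctr [r [P [r0 freeP CE]]]]|[p [w [w0 CE]]]]; last first.
  have cP s : `|s| < e -> (c0 s - p <= w)%MS by move=> /cC; rewrite CE.
  have [vw _ _] := all_in_plane cP; have Zw := Z_in_plane cP.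
  have [kv ve] := sub_rVP vw; have [kZ Ze] := sub_rVP Zw.
  have kv0 : kv != 0 by apply: contraNneq v0 => k0; rewrite ve k0 scale0r.
  by exists (kZ / kv); rewrite Ze ve scalerA divfK.
have cP s : `|s| < e -> (c0 s - ctr <= P)%MS by move=> /cC; rewrite CE => -[].
have cr s : `|s| < e -> dot (c0 s - ctr) (c0 s - ctr) = r ^+ 2.
  by move=> /cC; rewrite CE => -[_]; rewrite bform1E.
pose q t : E := c0 t - ctr.
have dq (t : R) i : `|t| < e -> is_derive t 1 (fun s => q s 0 i) (c1 t 0 i).
  move=> te; have := is_deriveB (d0 i te) (is_derive_cst (ctr 0 i) t 1).
  rewrite subr0; rewrite (_ : (fun s => q s 0 i) = (fun s => c0 s 0 i) - cst (ctr 0 i))//.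
  by apply/funext => s; rewrite !mxE.
have o1 t : `|t| < e -> dot (q t) (c1 t) = 0.
  move=> te; have := dot_derivative (fun i => dq t i te) (fun i => dq t i te).
  by move=> /(derive_constant cr te); rewrite [X in _ + X]dotC; lra.
have o2 t : `|t| < e -> dot (q t) (c2 t) + dot (c1 t) (c1 t) = 0.
  move=> te; have := dot_derivative (fun i => dq t i te) (fun i => d1 i te).
  exact: (derive_constant o1 te).
have o3 : dot (q 0) b + 3 * dot (c2 0) (c1 0) = 0.
  have := is_deriveD (dot_derivative (fun i => dq 0 i zlt) (c' := c1) (d' := fun=> b) d2)
    (dot_derivative (fun i => d1 i zlt) (fun i => d1 i zlt)).
  move=> /(derive_constant o2 zlt); rewrite [dot (c1 0) (c2 0)]dotC; lra.
have qq : dot (q 0) (q 0) != 0 by rewrite cr// gt_eqF// exprn_gt0.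
have qZ : dot (q 0) Z = 0.
  rewrite /Z dotBr !dotZr.
  have -> : dot (q 0) b = - (3 * dot (c2 0) (c1 0)) by apply/eqP; rewrite -addr_eq0; apply/eqP.
  have -> : dot (q 0) (c2 0) = - dot (c1 0) (c1 0) by apply/eqP; rewrite -addr_eq0 o2.
  by ring.
have qv := o1 0 zlt.
have vv : dot (c1 0) (c1 0) != 0.
  by apply: contraNneq v0 => /dot_eq0->.
have comb (D : 'M[R]_(1, 1 + 1)) : D *m col_mx (q 0) (c1 0) =
    lsubmx D 0 0 *: q 0 + rsubmx D 0 0 *: c1 0.
  rewrite -{1}(hsubmxK D) mul_row_col {1}[lsubmx D]mx11_scalar {1}[rsubmx D]mx11_scalar.
  by rewrite !mul_scalar_mx.
have free : row_free (col_mx (q 0) (c1 0)).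
  apply: inj_row_free => D; rewrite comb => h.
  have := congr1 (dot (q 0)) h; rewrite dotDr !dotZr qv mulr0 addr0.
  rewrite dotv0 => /eqP; rewrite mulf_eq0 (negbTE qq) orbF => /eqP l0.
  have := congr1 (dot (c1 0)) h; rewrite dotDr !dotZr [dot _ (q 0)]dotC qv mulr0 add0r.
  rewrite dotv0 => /eqP; rewrite mulf_eq0 (negbTE vv) orbF => /eqP r1.
  rewrite -(hsubmxK D) [lsubmx D]mx11_scalar [rsubmx D]mx11_scalar l0 r1.
  by rewrite !raddf0 row_mx0.
have [vP _ _] := all_in_plane cP.
have sP : (col_mx (q 0) (c1 0) <= P)%MS by rewrite col_mx_sub cP.
have PqV : (P <= col_mx (q 0) (c1 0))%MS.
  rewrite -(geq_leqif (mxrank_leqif_sup sP)).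
  by rewrite (eqP free) (eqP freeP).
have /submxP[D ZD] := submx_trans (Z_in_plane cP) PqV.
exists (rsubmx D 0 0).
have ZE := ZD; rewrite comb in ZE.
have := congr1 (dot (q 0)) ZE; rewrite qZ dotDr !dotZr qv mulr0 addr0 => /esym/eqP.
by rewrite mulf_eq0 (negbTE qq) orbF => /eqP l0; rewrite ZE l0 scale0r add0r.
Qed.

End CurvesOnCircles.

(** * The circle condition for geodesics *)

Section GeodesicCircles.
Context {R : realType} {n : nat}.
Local Notation E := 'rV[R]_n.+1.
Local Notation I := 'I_n.+1.

(** The third derivative of a geodesic at x with velocity v, obtained by
    differentiating the geodesic equation. *)
Definition geodesic_jerk (g : E -> 'M[R]_n.+1) (x v : E) (k : I) : R :=
  - \sum_i \sum_j
    ((\sum_l partial l (christoffel g k i j) x * v 0 l) * v 0 i * v 0 j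
     + christoffel g k i j x * (geodesic_acc g x v i * v 0 j + v 0 i * geodesic_acc g x v j)).

(** Only the first-order jet of the curve at t matters: c and c' need not be a
    geodesic and its velocity near t. *)
Lemma geodesic_acc_derivative (U : set E) (g : E -> 'M[R]_n.+1) (c c' : R -> E) (t : R) k :
  open U -> (forall k i j, class_C 1 U (christoffel g k i j)) -> U (c t) ->
  (forall i, is_derive t 1 (fun s => c s 0 i) (c' t 0 i)) ->
  (forall i, is_derive t 1 (fun s => c' s 0 i) (geodesic_acc g (c t) (c' t) i)) ->
  is_derive t 1 (fun s => geodesic_acc g (c s) (c' s) k) (geodesic_jerk g (c t) (c' t) k).
Proof.
move=> oU CG Uc dc dc'.
rewrite /geodesic_acc /geodesic_jerk; apply: is_deriveN.
apply: is_derive_sumf => i; apply: is_derive_sumf => j.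
have h := class_C1_chain oU (CG k i j) Uc dc.
apply: (is_derive_eq (is_deriveMf (is_deriveMf h (dc' i)) (dc' j))).
by rewrite /geodesic_acc; ring.
Qed.

Lemma geodesic_circle_identity (U : set E) (g : E -> 'M[R]_n.+1) (x v : E) :
  open U -> (forall k i j, class_C 1 U (christoffel g k i j)) ->
  geodesics_are_circles U g -> U x ->
  exists lam : R, forall k,
    dot v v * geodesic_jerk g x v k
    - 3 * (\sum_i geodesic_acc g x v i * v 0 i) * geodesic_acc g x v k = lam * v 0 k.
Proof.
move=> oU CG circ Ux.
have [e [c [c' [e0 cx cv h]]]] := geodesic_exists v oU CG Ux.
have z0 : `|0 : R| < e by rewrite normr0.
have dc (t : R) i : `|t| < e -> is_derive t 1 (fun s => c s 0 i) (c' t 0 i).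
  by move=> /h[_ + _]; exact.
pose c2 t : E := \row_k geodesic_acc g (c t) (c' t) k.
have dc' (t : R) i : `|t| < e -> is_derive t 1 (fun s => c' s 0 i) (c2 t 0 i).
  by move=> /h[_ _]; rewrite mxE; exact.
have row_derive (f f' : R -> E) (t : R) :
    (forall i, is_derive t 1 (fun s => f s 0 i) (f' t 0 i)) ->
    derivable f t 1 /\ 'D_1 f t = f' t.
  move=> df; have fd : derivable f t 1.
    by apply/derivable_mxP => i j; rewrite (ord1 i); have [] := df j.
  split=> //; rewrite derive_mx//; apply/matrixP => i j; rewrite mxE (ord1 i).
  by have [] := df j.
have d1c (t : R) : `|t| < e -> derive1 c t = c' t.
  by move=> te; rewrite derive1E; exact: (row_derive c c' t (fun i => dc t i te)).2.
have d2c (t : R) : `|t| < e -> derivable (derive1 c) t 1 /\ derive1 (derive1 c) t = c2 t.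
  move=> te; have [d d'] := row_derive c' c2 t (fun i => dc' t i te).
  have nc : \near t, c' t = derive1 c t by apply: (near_ball0 te) => s /d1c.
  split; first exact: near_eq_derivable nc d.
  by rewrite derive1E -d'; apply/esym/near_eq_derive.
have geo : geodesic U g [set t : R | `|t| < e] c.
  split.
  - rewrite openE => t /= te; exact: near_ball0 te (fun s hs => hs).
  - move=> a b /= ae be t /andP[at_ tb]; move: ae be; rewrite !ltr_norml.
    by move=> /andP[? ?] /andP[? ?]; apply/andP; split; lra.
  - by move=> t /h[].
  - move=> t te; split; last exact: (d2c t te).1.
    exact: (row_derive c c' t (fun i => dc t i te)).1.
  - move=> t te k; rewrite (d2c t te).2 (d1c t te) mxE /geodesic_acc.
    exact: addNr.
have [C circC cC] := circ _ _ geo.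
have db i : is_derive (0 : R) 1 (fun s => c2 s 0 i) ((\row_k geodesic_jerk g x v k : E) 0 i).
  rewrite mxE -cx -cv.
  rewrite (_ : (fun s => _) = fun s => geodesic_acc g (c s) (c' s) i); last first.
    by apply/funext => s; rewrite mxE.
  have [Uc _ h2] := h 0 z0.
  by apply: geodesic_acc_derivative oU CG Uc _ _ => // j; exact: dc.
have [|lam hlam] := circle_third_derivative e0 dc dc' db circC.
  by move=> t te; apply: cC; exists t.
exists lam => k.
have := congr1 (fun u : E => u 0 k) hlam; rewrite !mxE cv cx => <-.
by congr (_ - 3 * _ * _); rewrite /dot; apply: eq_bigr => i _; rewrite mxE cx cv.
Qed.

End GeodesicCircles.

(** * Remainders modulo 1 + s^2 *)

Section PolynomialFunctions.
Context {R : realType}.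
Implicit Types f g : R -> R.

(** With bare functions, stability under sums and products provides the
    polynomial, which never has to be written down. *)
Definition polyfun f := exists P : {poly R}, forall s, f s = P.[s].

Lemma polyfun_cst a : polyfun (fun=> a).
Proof. by exists a%:P => s; rewrite hornerC. Qed.

Lemma polyfun_id : polyfun id.
Proof. by exists 'X => s; rewrite hornerX. Qed.

Lemma polyfunD f g : polyfun f -> polyfun g -> polyfun (fun s => f s + g s).
Proof. by move=> [P hP] [Q hQ]; exists (P + Q) => s; rewrite hornerD hP hQ. Qed.

Lemma polyfunN f : polyfun f -> polyfun (fun s => - f s).
Proof. by move=> [P hP]; exists (- P) => s; rewrite hornerN hP. Qed.

Lemma polyfunM f g : polyfun f -> polyfun g -> polyfun (fun s => f s * g s).
Proof. by move=> [P hP] [Q hQ]; exists (P * Q) => s; rewrite hornerM hP hQ. Qed.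

Lemma polyfun_sum n (F : 'I_n -> R -> R) : (forall i, polyfun (F i)) ->
  polyfun (fun s => \sum_i F i s).
Proof.
move=> hF; have [P hP] := choice hF; exists (\sum_i P i) => s.
by rewrite horner_sum; apply: eq_bigr => i _.
Qed.

Lemma horner_eq0 (P : {poly R}) : (forall s, P.[s] = 0) -> P = 0.
Proof.
move=> h; apply/eqP; apply: contraT => P0.
have := @max_poly_roots _ P [seq i%:R | i <- iota 0 (size P)] P0.
rewrite size_map size_iota ltnn; apply.
  by apply/allP => _ /mapP[i _ ->]; rewrite /root h.
by rewrite map_inj_uniq ?iota_uniq//; apply: mulrIn; rewrite oner_eq0.
Qed.

(** A nonzero multiple of 1 + X^2 has degree at least 2. *)
Lemma remainder_eq0 f (al be : R) : polyfun f ->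
  (forall s, (1 + s * s) * f s = al + be * s) -> al = 0 /\ be = 0.
Proof.
move=> [P fP] h.
have e : (1 + 'X * 'X) * P = al%:P + be%:P * 'X.
  apply/eqP; rewrite -subr_eq0; apply/eqP/horner_eq0 => s.
  by rewrite !hornerE -fP h subrr.
have P0 : P = 0.
  apply/eqP; apply: contraT => P0.
  have s3 : size (1 + 'X * 'X : {poly R}) = 3.
    by rewrite addrC -expr2 size_polyDl ?size_polyXn ?size_poly1.
  have : (size (al%:P + be%:P * 'X)%R <= 2)%N.
    rewrite (leq_trans (size_polyD _ _))// geq_max (leq_trans (size_polyC_leq1 _))//=.
    by rewrite (leq_trans (size_polyMleq _ _))// size_polyX addnS /= addn1 ltnS size_polyC_leq1.
  rewrite -e size_mul// ?s3; last by rewrite -size_poly_eq0 s3.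
  by rewrite -size_poly_eq0 in P0; case: (size P) P0 => [|k]//; rewrite addnS.
rewrite P0 mulr0 in e.
have e0 := congr1 (fun Q => Q.[0]) e; have e1 := congr1 (fun Q => Q.[1]) e.
rewrite !hornerE in e0 e1; split; lra.
Qed.

End PolynomialFunctions.

Ltac polyfun_tac := repeat first
  [exact: polyfun_cst | exact: polyfun_id | apply: polyfunD | apply: polyfunN
  | apply: polyfunM | apply: polyfun_sum => ?].

Section Planes.
Context {R : realType}.
(** At s = i the right-hand side is, up to a factor, (u + i v) (v - i u), that
    is, - i (u + i v)^2; its real and imaginary parts are the two remainders. *)
Lemma isotropic_product (j A B : R -> R) (u v : R) : polyfun j -> polyfun A -> polyfun B ->
  (forall s, (1 + s * s) * j s =
     3 * ((u + v * s) + (1 + s * s) * A s) * ((v - u * s) + (1 + s * s) * B s)) ->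
  u = 0 /\ v = 0.
Proof.
move=> pj pA pB h.
have [h1 h2] : 6 * (u * v) = 0 /\ 3 * (v * v - u * u) = 0.
  apply: (@remainder_eq0 R (fun s => j s - 3 * (u + v * s) * B s - 3 * A s * (v - u * s)
     - 3 * (1 + s * s) * A s * B s + 3 * (u * v))) => [|s]; first by polyfun_tac.
  by rewrite !(mulrDr (1 + s * s)) h; ring.
have uv : u * v = 0 by lra.
have uu : v * v = u * u by lra.
move/eqP: uv; rewrite mulf_eq0 => /orP[]/eqP e; rewrite e ?mulr0 ?mul0r in uu *.
  by move/eqP: uu; rewrite mulf_eq0 orbb => /eqP.
by move/esym/eqP: uu; rewrite mulf_eq0 orbb => /eqP.
Qed.

(** The remainder of the right-hand side is the value (u + i v)^2 at s = i. *)
Lemma isotropic_square (j A : R -> R) (u v : R) : polyfun j -> polyfun A ->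
  (forall s, (1 + s * s) * j s = ((u + v * s) + (1 + s * s) * A s) ^+ 2) ->
  u = 0 /\ v = 0.
Proof.
move=> pj pA h.
have [h1 h2] : u * u - v * v = 0 /\ 2 * (u * v) = 0.
  apply: (@remainder_eq0 R (fun s => j s - 2 * (u + v * s) * A s
     - (1 + s * s) * A s * A s - v * v)) => [|s]; first by polyfun_tac.
  by rewrite !(mulrDr (1 + s * s)) h; ring.
have uv : u * v = 0 by lra.
have uu : v * v = u * u by lra.
move/eqP: uv; rewrite mulf_eq0 => /orP[]/eqP e; rewrite e ?mulr0 ?mul0r in uu *.
  by move/eqP: uu; rewrite mulf_eq0 orbb => /eqP.
by move/esym/eqP: uu; rewrite mulf_eq0 orbb => /eqP.
Qed.
End Planes.

(** * Accelerations at isotropic vectors *)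

Section FirstOrder.
Context {R : realType} {n : nat}.
Local Notation E := 'rV[R]_n.+1.
Local Notation I := 'I_n.+1.
Variables (g : E -> 'M[R]_n.+1) (x : E).
Local Notation G k i j := (christoffel g k i j x).

(** The polarization of [geodesic_acc]. *)
Definition acc_pair (u v : E) : E := \row_k - \sum_i \sum_j G k i j * u 0 i * v 0 j.

Lemma geodesic_acc_pencil (a b : E) s k : geodesic_acc g x (a + s *: b) k =
  acc_pair a a 0 k + s * (acc_pair a b 0 k + acc_pair b a 0 k) + s * s * acc_pair b b 0 k.
Proof.
rewrite /geodesic_acc !mxE -!opprD !mulrN -!opprD; congr (- _).
rewrite -big_split /= !mulr_sumr -!big_split /=; apply: eq_bigr => i _.
rewrite -big_split /= !mulr_sumr -!big_split /=; apply: eq_bigr => j _.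
by rewrite !mxE; ring.
Qed.

Lemma polyfun_acc (a b : E) k : polyfun (fun s => geodesic_acc g x (a + s *: b) k).
Proof.
rewrite (funext (fun s => geodesic_acc_pencil a b s k)); polyfun_tac.
Qed.

Lemma polyfun_pencil (a b : E) i : polyfun (fun s => (a + s *: b) 0 i).
Proof.
rewrite (_ : (fun s => _) = fun s => a 0 i + s * b 0 i); first by polyfun_tac.
by apply/funext => s; rewrite !mxE.
Qed.

Lemma polyfun_jerk (a b : E) k : polyfun (fun s => geodesic_jerk g x (a + s *: b) k).
Proof.
have [h1 h2] := (polyfun_pencil a b, polyfun_acc a b).
by rewrite /geodesic_jerk; polyfun_tac.
Qed.

Hypothesis circ : forall v : E, exists lam : R, forall k,
    dot v v * geodesic_jerk g x v k
    - 3 * (\sum_i geodesic_acc g x v i * v 0 i) * geodesic_acc g x v k = lam * v 0 k.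

Lemma circle_orthogonal (v w : E) : dot v w = 0 ->
  dot v v * (\sum_k geodesic_jerk g x v k * w 0 k) =
  3 * (\sum_i geodesic_acc g x v i * v 0 i) * (\sum_k geodesic_acc g x v k * w 0 k).
Proof.
move=> vw; have [lam] := circ v.
move: (dot v v) (\sum_i geodesic_acc g x v i * v 0 i) => d f h.
apply/eqP; rewrite -subr_eq0; apply/eqP; transitivity (lam * dot v w).
  rewrite /dot !mulr_sumr -sumrB; apply: eq_bigr => k _.
  by rewrite !mulrA -h; ring.
by rewrite vw mulr0.
Qed.

(** Let v = a + s b.  The vector b - s a is orthogonal to v, and it equals - i v
    at s = i; so the component of the circle identity along it reads
    <F(v), v>^2 = 0 at s = i.  The conclusion is the real part of
    <F(a + i b), a + i b> = 0. *)
Lemma acc_isotropic (a b : E) (N : R) : dot a b = 0 -> dot a a = N -> dot b b = N ->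
  dot (acc_pair a a) a - dot (acc_pair b b) a - dot (acc_pair a b + acc_pair b a) b = 0.
Proof.
move=> ab aN bN.
set p0 := dot (acc_pair a a) a; set p2 := dot (acc_pair b b) a.
set q1 := dot (acc_pair a b + acc_pair b a) b.
set q0 := dot (acc_pair a a) b; set q2 := dot (acc_pair b b) b.
set p1 := dot (acc_pair a b + acc_pair b a) a.
have aw s (w : E) : \sum_k geodesic_acc g x (a + s *: b) k * w 0 k =
    dot (acc_pair a a) w + s * dot (acc_pair a b + acc_pair b a) w
      + s * s * dot (acc_pair b b) w.
  rewrite /dot !mulr_sumr -!big_split; apply: eq_bigr => k _.
  by rewrite geodesic_acc_pencil [(_ + _ : E) 0 k]mxE /=; ring.
have sumD (F : I -> R) (u w : E) s :
    \sum_k F k * (u + s *: w) 0 k = \sum_k F k * u 0 k + s * \sum_k F k * w 0 k.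
  by rewrite mulr_sumr -big_split; apply: eq_bigr => k _; rewrite !mxE /=; ring.
have vv s : dot (a + s *: b) (a + s *: b) = N * (1 + s * s).
  rewrite !(dotDr, dotZr) ![dot (a + _) _]dotC !(dotDr, dotZr) aN bN [dot b a]dotC ab.
  by ring.
have vw s : dot (a + s *: b) (b - s *: a) = 0.
  rewrite dotBr dotZr ![dot (a + _) _]dotC !(dotDr, dotZr) aN bN [dot b a]dotC ab.
  by ring.
have [] // := @isotropic_product R
  (fun s => N * \sum_k geodesic_jerk g x (a + s *: b) k * (b - s *: a) 0 k)
  (fun s => p2 + q1 + q2 * s) (fun s => q2 - p1 - p2 * s)
  (p0 - p2 - q1) (p1 + q0 - q2).
- apply: polyfunM; first exact: polyfun_cst.
  apply: polyfun_sum => k; apply: polyfunM; first exact: polyfun_jerk.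
  rewrite (_ : (fun s => _) = fun s => b 0 k - s * a 0 k); first by polyfun_tac.
  by apply/funext => s; rewrite !mxE.
- by polyfun_tac.
- by polyfun_tac.
move=> s; have := circle_orthogonal (vw s); rewrite vv mulrA [_ * N]mulrC => ->.
rewrite -scaleNr !sumD !aw -/p0 -/p1 -/p2 -/q0 -/q1 -/q2; ring.
Qed.

End FirstOrder.

(** * The Christoffel symbols in dimension three *)

Section AccPair.
Context {R : realType} {n : nat}.
Local Notation E := 'rV[R]_n.+1.
Local Notation e_ i := (delta_mx 0 i : E).
Variables (g : E -> 'M[R]_n.+1) (x : E).
Local Notation ap := (acc_pair g x).

Lemma acc_pairDl u v w : ap (u + v) w = ap u w + ap v w.
Proof.
apply/rowP => k; rewrite !mxE -opprD -big_split; congr (- _); apply: eq_bigr => i _.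
by rewrite -big_split; apply: eq_bigr => j _; rewrite !mxE /=; ring.
Qed.

Lemma acc_pairDr u v w : ap u (v + w) = ap u v + ap u w.
Proof.
apply/rowP => k; rewrite !mxE -opprD -big_split; congr (- _); apply: eq_bigr => i _.
by rewrite -big_split; apply: eq_bigr => j _; rewrite !mxE /=; ring.
Qed.

Lemma acc_pairZl c u v : ap (c *: u) v = c *: ap u v.
Proof.
apply/rowP => k; rewrite !mxE mulrN mulr_sumr; congr (- _); apply: eq_bigr => i _.
by rewrite mulr_sumr; apply: eq_bigr => j _; rewrite !mxE /=; ring.
Qed.

Lemma acc_pairZr c u v : ap u (c *: v) = c *: ap u v.
Proof.
apply/rowP => k; rewrite !mxE mulrN mulr_sumr; congr (- _); apply: eq_bigr => i _.
by rewrite mulr_sumr; apply: eq_bigr => j _; rewrite !mxE /=; ring.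
Qed.

Lemma sum_delta (F : 'I_n.+1 -> R) (i : 'I_n.+1) : \sum_k F k * (e_ i) 0 k = F i.
Proof.
rewrite (bigD1 i)//= big1 ?addr0; first by rewrite mxE !eqxx mulr1.
by move=> k ki; rewrite mxE eqxx (negbTE ki) mulr0.
Qed.

Lemma acc_pair_delta i j k : ap (e_ i) (e_ j) 0 k = - christoffel g k i j x.
Proof.
rewrite mxE; congr (- _).
transitivity (\sum_p christoffel g k p j x * (e_ i) 0 p); last exact: sum_delta.
by apply: eq_bigr => p _; exact: sum_delta.
Qed.

Lemma dot_delta (u : E) i : dot u (e_ i) = u 0 i.
Proof. exact: sum_delta. Qed.

Lemma dot_delta2 (i j : 'I_n.+1) : dot (e_ i) (e_ j) = (i == j)%:R :> R.
Proof. by rewrite dot_delta mxE eqxx eq_sym. Qed.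

End AccPair.

Lemma christoffel_sym (R : realType) n (U : set 'rV[R]_n.+1) 
    (g : 'rV[R]_n.+1 -> 'M[R]_n.+1) k i j y :
  open U -> (forall z, U z -> (g z)^T = g z) -> U y ->
  christoffel g k i j y = christoffel g k j i y.
Proof.
move=> oU gT Uy; rewrite /christoffel; congr (_ * _); apply: eq_bigr => l _; congr (_ * _).
rewrite (@partial_eq R n U (fun z => g z i j) (fun z => g z j i) y l)//.
  by rewrite [X in X - _]addrC.
by move=> z Uz; rewrite -{1}(gT z Uz) mxE.
Qed.

Lemma is_derive_line_coord (R : realType) (n : nat) (y v : 'rV[R]_n.+1) (t : R) i :
  is_derive t 1 (fun s => (y + s *: v) 0 i) (v 0 i).
Proof.
rewrite (_ : (fun s => _) = fun s => y 0 i + s * v 0 i); last first.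
  by apply/funext => s; rewrite !mxE.
have := is_deriveD (is_derive_cst (y 0 i) t 1)
  (is_deriveMf (is_derive_id t 1) (is_derive_cst (v 0 i) t 1)).
by rewrite mulr0 !add0r mul1r.
Qed.

Lemma near_line (R : realType) (n : nat) (U : set 'rV[R]_n.+1) (y v : 'rV[R]_n.+1) :
  open U -> U y -> \forall s \near (0 : R), U (y + s *: v).
Proof.
move=> oU Uy; have [r r0 rU] := open_box oU Uy.
pose B := 1 + \sum_i `|v 0 i|.
have B0 : 0 < B by rewrite ltr_wpDr// sumr_ge0.
have rB : `|0 : R| < r / B by rewrite normr0 divr_gt0.
apply: (near_ball0 (P := fun s => U (y + s *: v)) rB) => s sr; apply: rU => i.
rewrite !mxE addrAC subrr add0r normrM (le_trans _ (ltW _ : `|s| * B <= r))//; last first.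
  by rewrite -ltr_pdivlMr.
by rewrite ler_wpM2l// /B (bigD1 i)//= addrCA lerDl addr_ge0// sumr_ge0.
Qed.

(** A bilinear form that vanishes on the pairs of orthogonal vectors is a
    multiple of the Euclidean product; here it is D - m m^T. *)
Lemma orthogonal_quadratic {R : realType} {n : nat} (D : 'I_n.+1 -> 'I_n.+1 -> R)
    (m : 'I_n.+1 -> R) :
  (forall v w : 'rV[R]_n.+1, v != 0 -> dot v w = 0 ->
    \sum_k (\sum_l D l k * v 0 l) * w 0 k = (\sum_k m k * v 0 k) * (\sum_k m k * w 0 k)) ->
  forall i j, D i j = m i * m j + (i == j)%:R * (D ord0 ord0 - m ord0 * m ord0).
Proof.
move=> H i j.
pose e a : 'rV[R]_n.+1 := delta_mx 0 a.
have e0 a : e a != 0.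
  by apply/eqP => /(congr1 (fun u : 'rV[R]_n.+1 => u 0 a)) /eqP; rewrite !mxE !eqxx oner_eq0.
have off a b : a != b -> D a b = m a * m b.
  move=> ab; have := H (e a) (e b) (e0 a).
  by rewrite dot_delta2 (negbTE ab) => /(_ erefl); rewrite !sum_delta.
have diag a b : D a a - m a * m a = D b b - m b * m b.
  have [->//|ab] := eqVneq a b; have ba : b != a by rewrite eq_sym.
  have sD (F : 'I_n.+1 -> R) s : \sum_k F k * (e a + s *: e b) 0 k = F a + s * F b.
    rewrite -(sum_delta F a) -(sum_delta F b) mulr_sumr -big_split; apply: eq_bigr => k _.
    by rewrite !mxE /=; ring.
  have perp : dot (e a + 1 *: e b) (e a + (-1) *: e b) = 0.
    rewrite dotDr dotZr !dot_delta !coord_add_line !mxE !eqxx (negbTE ab) (negbTE ba) /=.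
    by rewrite !mulr0n !mulr1n; ring.
  have nz : e a + 1 *: e b != 0.
    apply/eqP => /(congr1 (fun u : 'rV[R]_n.+1 => u 0 a)) /eqP.
    by rewrite coord_add_line !mxE !eqxx (negbTE ab) mulr0n addr0 oner_eq0.
  have := H _ _ nz perp; rewrite !sD (off a b ab) (off b a ba) => h.
  by apply/eqP; rewrite -subr_eq0; apply/eqP; lra.
have [->|ij] := eqVneq i j; last by rewrite off// mul0r addr0.
by rewrite mul1r -(diag j); ring.
Qed.

Section Dimension3.
Context {R : realType}.
Local Notation E := 'rV[R]_3.
Local Notation I := 'I_3.
Local Notation e_ i := (delta_mx 0 i : E).

Lemma sum_distinct (i j k : I) (F : I -> R) : i != j -> i != k -> j != k ->
  \sum_l F l = F i + F j + F k.
Proof.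
move=> ij ik jk; rewrite (bigD1 i)//= (bigD1 j) 1?eq_sym//= (bigD1 k) /=; last first.
  by rewrite ![k == _]eq_sym ik.
rewrite big1 ?addr0 ?addrA// => l /andP[/andP[li lj] lk].
have u : uniq [:: i; j; k; l].
  by rewrite /= !inE !negb_or ij ik jk ![_ == l]eq_sym li lj lk.
by have := max_card (mem [:: i; j; k; l]); rewrite (card_uniqP u) card_ord.
Qed.

Variables (U : set E) (g : E -> 'M[R]_3).
Hypothesis oU : open U.
Hypothesis Gsmooth : forall k i j, smooth U (christoffel g k i j).
Hypothesis Gsym : forall y k i j, U y -> christoffel g k i j y = christoffel g k j i y.
Hypothesis circ : forall y v, U y -> exists lam : R, forall k,
    dot v v * geodesic_jerk g y v k
    - 3 * (\sum_i geodesic_acc g y v i * v 0 i) * geodesic_acc g y v k = lam * v 0 k.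

Lemma christoffel_trace_free y i j : U y -> i != j ->
  christoffel g i i i y = christoffel g i j j y + 2 * christoffel g j i j y.
Proof.
move=> Uy ij.
have := acc_isotropic (fun v => circ v Uy) (a := e_ i) (b := e_ j) (N := 1).
rewrite !dot_delta2 !eqxx (negbTE ij) => /(_ erefl erefl erefl).
rewrite !dot_delta ![(_ + _ : E) 0 _]mxE !acc_pair_delta [christoffel g j j i y]Gsym//; lra.
Qed.

(** The coefficient of v_i v_j v_k in <F(v), v> is invisible in the coordinate
    planes; the orthogonal vectors 5 e_i and 3 e_j + 4 e_k of length 5 detect
    it. *)
Lemma christoffel_cyclic y i j k : U y -> i != j -> i != k -> j != k ->
  christoffel g i j k y + christoffel g j i k y + christoffel g k i j y = 0.
Proof.
move=> Uy ij ik jk.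
have := acc_isotropic (fun v => circ v Uy) (a := 5 *: e_ i) (b := 3 *: e_ j + 4 *: e_ k) (N := 25).
have dl (u v w : E) : dot (u + v) w = dot u w + dot v w by rewrite !(dotC _ w) dotDr.
have zl c (u v : E) : dot (c *: u) v = c * dot u v by rewrite !(dotC _ v) dotZr.
rewrite !(acc_pairDl, acc_pairDr, acc_pairZl, acc_pairZr, dotDr, dl, dotZr, zl).
rewrite !dot_delta2 !eqxx ![k == _]eq_sym (negbTE ij) (negbTE ik) (negbTE jk).
rewrite !dot_delta !acc_pair_delta.
rewrite [christoffel g j j i y]Gsym// [christoffel g j k i y]Gsym//.
rewrite [christoffel g k j i y]Gsym// [christoffel g k k i y]Gsym// [christoffel g i k j y]Gsym//.
have := christoffel_trace_free Uy ij; have := christoffel_trace_free Uy ik.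
move=> h1 h2 h; have {}h := h _ _ _; have [e1 e2 e3] : [/\ 5 * (3 * 0 + 4 * 0) = 0 :> R,
  5 * (5 * 1) = 25 :> R & 3 * (3 * 1 + 4 * 0) + 4 * (3 * 0 + 4 * 1) = 25 :> R] by split; lra.
have := h e1 e2 e3; lra.
Qed.

(** The coefficients of the linear form lambda with <F(v), v> = |v|^2 lambda(v). *)
Definition radial_coef (i : I) (y : E) : R := - christoffel g i i i y.

(** Vanishing at all isotropic vectors means divisibility by |v|^2. *)
Lemma acc_radial y v : U y ->
  \sum_k geodesic_acc g y v k * v 0 k = dot v v * \sum_i radial_coef i y * v 0 i.
Proof.
move=> Uy.
pose o0 : I := @Ordinal 3 0 isT; pose o1 : I := @Ordinal 3 1 isT; pose o2 : I := @Ordinal 3 2 isT.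
have s3 (F : I -> R) : \sum_l F l = F o0 + F o1 + F o2 by apply: sum_distinct.
rewrite /geodesic_acc /dot /radial_coef !s3.
have tf i j : i != j -> christoffel g i j j y = christoffel g i i i y - 2 * christoffel g j i j y.
  by move=> /(christoffel_trace_free Uy) ->; rewrite addrK.
have cy : christoffel g o0 o1 o2 y = - christoffel g o1 o0 o2 y - christoffel g o2 o0 o1 y.
  by have := christoffel_cyclic Uy (i := o0) (j := o1) (k := o2) isT isT isT; lra.
rewrite (tf o0 o1)// (tf o0 o2)// (tf o1 o0)// (tf o1 o2)// (tf o2 o0)// (tf o2 o1)//.
have sy k i j := Gsym k i j Uy.
rewrite [christoffel g o0 o2 o1 y]sy [christoffel g o1 o2 o0 y]sy [christoffel g o2 o1 o0 y]sy.
rewrite [christoffel g o0 o1 o0 y]sy [christoffel g o0 o2 o0 y]sy [christoffel g o1 o1 o0 y]sy.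
rewrite [christoffel g o1 o2 o1 y]sy [christoffel g o2 o2 o0 y]sy [christoffel g o2 o2 o1 y]sy cy.
by ring.
Qed.

(** The derivative of lambda(v) along a geodesic with velocity v. *)
Definition radial_flow (y v : E) : R := \sum_i
  (radial_coef i y * geodesic_acc g y v i + (\sum_l partial l (radial_coef i) y * v 0 l) * v 0 i).

Lemma smooth_radial_coef i : smooth U (radial_coef i).
Proof. exact: smoothN. Qed.

(** Both sides of [acc_radial] are differentiated along the pair
    (y + s v, v + s F(v)), which at s = 0 agrees to first order with the geodesic
    and its velocity. *)
Lemma jerk_energy y v : U y ->
  \sum_k geodesic_jerk g y v k * v 0 k + \sum_k geodesic_acc g y v k * geodesic_acc g y v k =
  dot v v * (2 * (\sum_i radial_coef i y * v 0 i) ^+ 2 + radial_flow y v).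
Proof.
move=> Uy.
pose F : E := \row_k geodesic_acc g y v k.
pose c (s : R) := y + s *: v; pose w (s : R) := v + s *: F.
have c0 : c 0 = y by rewrite /c scale0r addr0.
have w0 : w 0 = v by rewrite /w scale0r addr0.
have dc i : is_derive (0 : R) 1 (fun s => c s 0 i) (w 0 0 i).
  by rewrite w0; exact: is_derive_line_coord.
have dw i : is_derive (0 : R) 1 (fun s => w s 0 i) (geodesic_acc g (c 0) (w 0) i).
  have := is_derive_line_coord v F 0 i; rewrite c0 w0; by rewrite mxE.
have Uc : U (c 0) by rewrite c0.
have CG k i j : class_C 1 U (christoffel g k i j) by exact: Gsmooth.
have D1 : is_derive (0 : R) 1 (fun s => \sum_k geodesic_acc g (c s) (w s) k * w s 0 k)
    (\sum_k (geodesic_acc g (c 0) (w 0) k * geodesic_acc g (c 0) (w 0) k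
      + geodesic_jerk g (c 0) (w 0) k * w 0 0 k)).
  apply: is_derive_sumf => k; apply: is_deriveMf => //.
  exact: geodesic_acc_derivative oU CG Uc dc dw.
have D2 : is_derive (0 : R) 1 (fun s => dot (w s) (w s) * \sum_i radial_coef i (c s) * w s 0 i)
   (dot (w 0) (w 0) * radial_flow (c 0) (w 0) +
    (\sum_i (w 0 0 i * geodesic_acc g (c 0) (w 0) i + geodesic_acc g (c 0) (w 0) i * w 0 0 i))
      * \sum_i radial_coef i (c 0) * w 0 0 i).
  apply: is_deriveMf; first by apply: is_derive_sumf => i; exact: is_deriveMf.
  apply: is_derive_sumf => i; apply: is_deriveMf => //.
  by apply: (class_C1_chain oU (smooth_radial_coef i 1) Uc dc).
have near0 : \forall s \near (0 : R), \sum_k geodesic_acc g (c s) (w s) k * w s 0 k =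
    dot (w s) (w s) * \sum_i radial_coef i (c s) * w s 0 i.
  by apply: filterS (near_line v oU Uy) => s; exact: acc_radial.
have := near_eq_derive (1 : R) near0.
case: D1 => _ ->; case: D2 => _ ->; rewrite c0 w0 big_split /= addrC => ->.
have -> : \sum_i (v 0 i * geodesic_acc g y v i + geodesic_acc g y v i * v 0 i) =
    2 * \sum_i geodesic_acc g y v i * v 0 i.
  by rewrite mulr_sumr; apply: eq_bigr => i _; ring.
by rewrite (acc_radial _ Uy); ring.
Qed.

(** With v = e_i + s e_j, the circle identity divided by |v|^2 gives
    <J, v> = 0 modulo 1 + s^2, hence |F|^2 = 0 by [jerk_energy].  At s = i the
    components of F along e_i and e_j contribute nothing to |F|^2, since
    <F, v> = 0; so the component along e_k vanishes there. *)
Lemma christoffel_normal y i j k : U y -> i != j -> i != k -> j != k ->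
  christoffel g k i i y = christoffel g k j j y /\ christoffel g k i j y = 0.
Proof.
move=> Uy ij ik jk.
pose v (s : R) := e_ i + s *: e_ j.
have v_ s : [/\ v s 0 i = 1, v s 0 j = s & v s 0 k = 0].
  rewrite /v !coord_add_line !mxE !eqxx [j == i]eq_sym [k == i]eq_sym [k == j]eq_sym.
  rewrite (negbTE ij) (negbTE ik) (negbTE jk) /= !mulr0n !mulr1n.
  by split; rewrite ?addr0 ?add0r.
have s3 F : \sum_l F l = F i + F j + F k := sum_distinct F ij ik jk.
have vv s : dot (v s) (v s) = 1 + s * s.
  by rewrite /dot s3; have [-> -> ->] := v_ s; ring.
have acck s : geodesic_acc g y (v s) k =
   - christoffel g k i i y - 2 * christoffel g k i j y * s - christoffel g k j j y * s * s.
  rewrite geodesic_acc_pencil !acc_pair_delta [christoffel g k j i y]Gsym//; ring.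
have pA l : polyfun (fun s => geodesic_acc g y (v s) l) by exact: polyfun_acc.
have pJ l : polyfun (fun s => geodesic_jerk g y (v s) l) by exact: polyfun_jerk.
have pv l : polyfun (fun s => v s 0 l) by exact: polyfun_pencil.
pose La s := radial_coef i y + radial_coef j y * s.
have pLa : polyfun La by rewrite /La; polyfun_tac.
have pM : polyfun (fun s => radial_flow y (v s)) by rewrite /radial_flow; polyfun_tac.
have Lav s : \sum_l radial_coef l y * v s 0 l = La s.
  by rewrite s3 /La; have [-> -> ->] := v_ s; ring.
(* the quotient of (F_k)^2 by 1 + s^2; the remainder of F_k is
   Gamma^k_jj - Gamma^k_ii - 2 Gamma^k_ij s *)
have [] := @isotropic_square R (fun s => 2 * (La s * La s) + radial_flow y (v s)
    - geodesic_jerk g y (v s) i - 3 * La s * La s + 3 * La s * geodesic_acc g y (v s) i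
    - (1 + s * s) * (La s * La s) + 2 * s * La s * geodesic_acc g y (v s) j
    - geodesic_acc g y (v s) j * geodesic_acc g y (v s) j)
  (fun=> - christoffel g k j j y)
  (christoffel g k j j y - christoffel g k i i y) (- (2 * christoffel g k i j y)).
- by polyfun_tac.
- by polyfun_tac.
- move=> s.
  have pos : 1 + s * s != 0 by rewrite gt_eqF// -expr2 ltr_pwDl// sqr_ge0.
  have perp : dot (v s) (e_ j - s *: e_ i) = 0.
    by rewrite dotBr dotZr !dot_delta; have [-> -> _] := v_ s; ring.
  have h1 := circle_orthogonal (fun v => circ v Uy) perp.
  have h2 := jerk_energy (v s) Uy.
  have h3 := acc_radial (v s) Uy.
  rewrite h3 vv Lav in h1; rewrite vv Lav in h2; rewrite vv Lav in h3.
  have w_ (F : I -> R) : \sum_l F l * (e_ j - s *: e_ i) 0 l = F j - s * F i.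
    rewrite s3 -scaleNr !coord_add_line !mxE !eqxx [j == i]eq_sym [k == i]eq_sym [k == j]eq_sym.
    by rewrite (negbTE ij) (negbTE ik) (negbTE jk) /= !mulr0n !mulr1n; ring.
  rewrite !w_ in h1.
  have {}h1 : geodesic_jerk g y (v s) j - s * geodesic_jerk g y (v s) i =
    3 * La s * (geodesic_acc g y (v s) j - s * geodesic_acc g y (v s) i).
    by apply: (mulfI pos); rewrite h1; ring.
  rewrite !s3 in h2 h3; have [vi vj vk] := v_ s; rewrite vi vj vk !mulr0 !addr0 !mulr1 in h2 h3.
  rewrite (_ : christoffel g k j j y - christoffel g k i i y + - (2 * christoffel g k i j y) * s
    + (1 + s * s) * - christoffel g k j j y = geodesic_acc g y (v s) k); last first.
    by rewrite acck; ring.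
  move: h1 h2 h3; move: (radial_flow y (v s)) (La s) => M L.
  move: (geodesic_acc g y (v s) i) (geodesic_acc g y (v s) j) => Fi Fj.
  move: (geodesic_acc g y (v s) k) => Fk.
  move: (geodesic_jerk g y (v s) i) (geodesic_jerk g y (v s) j) => Ji Jj h1 h2 h3.
  have -> : Fk ^+ 2 = (1 + s * s) * (2 * L ^+ 2 + M) - (Ji + Jj * s) - Fi * Fi - Fj * Fj.
    by rewrite -h2; ring.
  have -> : Jj = s * Ji + 3 * L * (Fj - s * Fi) by rewrite -h1; ring.
  have -> : Fi = (1 + s * s) * L - Fj * s by rewrite -h3; ring.
  by ring.
by move=> h1 h2; split; lra.
Qed.

Lemma next_index : {f : I -> I | forall i, i != f i}.
Proof. by exists (@ordS 3) => -[[|[|[|]]]]. Qed.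

Definition other_index (i : I) : I := sval next_index i.

Lemma other_index_neq (i : I) : i != other_index i.
Proof. by rewrite /other_index; case: next_index. Qed.

(** The one-form p of the normal form F(v) = |v|^2 m - 2 p(v) v; replacing it by
    another one only reparametrizes the geodesics. *)
Definition pcoef (i : I) (y : E) : R := christoffel g (other_index i) i (other_index i) y.
(** The vector field m of the normal form.  When p = m, the connection is that of
    a conformally flat metric e^(2 f) |dx|^2 with df = m. *)
Definition mcoef (k : I) (y : E) : R := - christoffel g k (other_index k) (other_index k) y.

Lemma smooth_pcoef i : smooth U (pcoef i). Proof. exact: Gsmooth. Qed.
Lemma smooth_mcoef i : smooth U (mcoef i). Proof. exact: smoothN. Qed.

(** The symbols Gamma^k_ij with distinct indices vanish and Gamma^k_ii does not
    depend on i for i != k, by [christoffel_normal]; the remaining ones are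
    related by [christoffel_trace_free]. *)
Lemma christoffel_form y k i j : U y -> christoffel g k i j y =
  pcoef i y * (k == j)%:R + pcoef j y * (k == i)%:R - (i == j)%:R * mcoef k y.
Proof.
move=> Uy; rewrite /pcoef /mcoef.
have mE a b : a != b -> christoffel g a b b y = christoffel g a (other_index a) (other_index a) y.
  move=> ab; have [->//|bS] := eqVneq b (other_index a).
  by rewrite (christoffel_normal Uy bS _ _).1 // eq_sym// other_index_neq.
have tf a b : a != b -> 2 * christoffel g b a b y =
    christoffel g a a a y - christoffel g a (other_index a) (other_index a) y.
  by move=> ab; rewrite -(mE a b ab) (christoffel_trace_free Uy ab); ring.
have pE a b : a != b -> christoffel g b a b y = christoffel g (other_index a) a (other_index a) y.
  by move=> ab; have := tf a b ab; have := tf a (other_index a) (other_index_neq a); lra.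
have [->|ij] := eqVneq i j.
  have [->|kj] := eqVneq k j; last by rewrite (mE k j kj) /=; ring.
  by have := tf j (other_index j) (other_index_neq j) => /=; lra.
have [->|kj] := eqVneq k j.
  by rewrite [j == i]eq_sym (negbTE ij) (pE i j ij) /=; ring.
have [->|ki] := eqVneq k i.
  by rewrite [christoffel g i i j y]Gsym// (pE j i) 1?eq_sym// /=; ring.
by rewrite (christoffel_normal Uy ij _ _).2 1?eq_sym// /=; ring.
Qed.

Lemma acc_projective_conformal y v k : U y -> geodesic_acc g y v k =
  dot v v * mcoef k y - 2 * (\sum_i pcoef i y * v 0 i) * v 0 k.
Proof.
move=> Uy; rewrite /geodesic_acc.
have dl (F : I -> R) : \sum_i F i * (k == i)%:R = F k.
  by rewrite (bigD1 k)//= eqxx mulr1 big1 ?addr0// => i ik; rewrite eq_sym (negbTE ik) mulr0.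
transitivity (- \sum_i ((pcoef i y * v 0 i) * v 0 k
   + (\sum_j pcoef j y * v 0 j) * v 0 i * (k == i)%:R - v 0 i * v 0 i * mcoef k y)).
  congr (- _); apply: eq_bigr => i _.
  have -> : pcoef i y * v 0 i * v 0 k = \sum_j pcoef i y * v 0 i * v 0 j * (k == j)%:R by rewrite dl.
  have -> : v 0 i * v 0 i * mcoef k y = \sum_j v 0 i * v 0 j * mcoef k y * (i == j)%:R.
    rewrite (bigD1 i)//= eqxx mulr1 big1 ?addr0// => j ji; rewrite eq_sym (negbTE ji) mulr0//.
  rewrite !mulr_suml -big_split -sumrB; apply: eq_bigr => j _.
  by rewrite christoffel_form//=; ring.
rewrite sumrB big_split /= dl -!mulr_suml /dot; ring.
Qed.

(** The derivative of p(v) along a geodesic with velocity v. *)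
Definition pcoef_flow (y v : E) : R := \sum_i
  (pcoef i y * geodesic_acc g y v i + (\sum_l partial l (pcoef i) y * v 0 l) * v 0 i).

(** As in [jerk_energy], [acc_projective_conformal] is differentiated along
    the pair (y + s v, v + s F(v)). *)
Lemma jerk_projective_conformal y v k : U y -> geodesic_jerk g y v k =
  dot v v * (\sum_l partial l (mcoef k) y * v 0 l)
  + 2 * (\sum_i geodesic_acc g y v i * v 0 i) * mcoef k y
  - 2 * (\sum_i pcoef i y * v 0 i) * geodesic_acc g y v k - 2 * pcoef_flow y v * v 0 k.
Proof.
move=> Uy.
pose F : E := \row_k geodesic_acc g y v k.
pose c (s : R) := y + s *: v; pose w (s : R) := v + s *: F.
have c0 : c 0 = y by rewrite /c scale0r addr0.
have w0 : w 0 = v by rewrite /w scale0r addr0.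
have dc i : is_derive (0 : R) 1 (fun s => c s 0 i) (w 0 0 i).
  by rewrite w0; exact: is_derive_line_coord.
have dw i : is_derive (0 : R) 1 (fun s => w s 0 i) (geodesic_acc g (c 0) (w 0) i).
  have := is_derive_line_coord v F 0 i; rewrite c0 w0; by rewrite mxE.
have Uc : U (c 0) by rewrite c0.
have CG k' i j : class_C 1 U (christoffel g k' i j) by exact: Gsmooth.
have D1 := geodesic_acc_derivative k oU CG Uc dc dw.
have dp : is_derive (0 : R) 1 (fun s => \sum_i pcoef i (c s) * w s 0 i) (pcoef_flow (c 0) (w 0)).
  apply: is_derive_sumf => i; apply: is_deriveMf => //.
  by apply: (class_C1_chain oU (smooth_pcoef i 1) Uc dc).
have dd : is_derive (0 : R) 1 (fun s => dot (w s) (w s))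
    (\sum_i (w 0 0 i * geodesic_acc g (c 0) (w 0) i + geodesic_acc g (c 0) (w 0) i * w 0 0 i)).
  by apply: is_derive_sumf => i; exact: is_deriveMf.
have dm : is_derive (0 : R) 1 (fun s => mcoef k (c s)) (\sum_l partial l (mcoef k) (c 0) * w 0 0 l).
  by apply: (class_C1_chain oU (smooth_mcoef k 1) Uc dc).
have D2 := is_deriveB (is_deriveMf dd dm)
  (is_deriveMf (is_deriveMf (is_derive_cst (2 : R) (0 : R) 1) dp) (dw k)).
have near0 : \forall s \near (0 : R), geodesic_acc g (c s) (w s) k =
    dot (w s) (w s) * mcoef k (c s) - 2 * (\sum_i pcoef i (c s) * w s 0 i) * w s 0 k.
  by apply: filterS (near_line v oU Uy) => s; exact: acc_projective_conformal.
have := near_eq_derive (1 : R) near0.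
case: D1 => _ ->; case: D2 => _ D2 e.
rewrite c0 w0 in D2 e; rewrite e.
apply: (etrans D2).
have -> : \sum_i (v 0 i * geodesic_acc g y v i + geodesic_acc g y v i * v 0 i) =
    2 * \sum_i geodesic_acc g y v i * v 0 i.
  by rewrite mulr_sumr; apply: eq_bigr => i _; ring.
by rewrite /cst; ring.
Qed.

(** The component of the circle identity along w, with the normal forms of F and
    J; all the terms in p cancel. *)
Lemma mcoef_derivative_orthogonal y v w : U y -> v != 0 -> dot v w = 0 ->
  \sum_k (\sum_l partial l (mcoef k) y * v 0 l) * w 0 k =
  (\sum_k mcoef k y * v 0 k) * (\sum_k mcoef k y * w 0 k).
Proof.
move=> Uy v0 vw.
have vv : dot v v != 0 by apply: contraNneq v0 => /dot_eq0->.
have h := circle_orthogonal (fun v => circ v Uy) vw.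
pose P := \sum_i pcoef i y * v 0 i; pose M := \sum_k mcoef k y * v 0 k.
pose W := \sum_k mcoef k y * w 0 k.
have Fw : \sum_k geodesic_acc g y v k * w 0 k = dot v v * W.
  rewrite (eq_bigr (fun k => dot v v * (mcoef k y * w 0 k) - 2 * P * (v 0 k * w 0 k))).
    by rewrite sumrB -!mulr_sumr -/(dot v w) vw mulr0 subr0.
  by move=> k _; rewrite acc_projective_conformal// -/P; ring.
have Fv : \sum_k geodesic_acc g y v k * v 0 k = dot v v * (M - 2 * P).
  rewrite (eq_bigr (fun k => dot v v * (mcoef k y * v 0 k) - 2 * P * (v 0 k * v 0 k))).
    by rewrite sumrB -!mulr_sumr -/(dot v v) -/M; ring.
  by move=> k _; rewrite acc_projective_conformal// -/P; ring.
have Jw : \sum_k geodesic_jerk g y v k * w 0 k =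
    dot v v * (\sum_k (\sum_l partial l (mcoef k) y * v 0 l) * w 0 k)
    + 2 * (dot v v * (M - 2 * P)) * W - 2 * P * (dot v v * W).
  rewrite (eq_bigr (fun k => dot v v * ((\sum_l partial l (mcoef k) y * v 0 l) * w 0 k)
    + 2 * (dot v v * (M - 2 * P)) * (mcoef k y * w 0 k)
    - 2 * P * (geodesic_acc g y v k * w 0 k) - 2 * pcoef_flow y v * (v 0 k * w 0 k))).
    by rewrite !sumrB big_split /= -!mulr_sumr Fw -/(dot v w) vw -/W mulr0 subr0.
  by move=> k _; rewrite jerk_projective_conformal// -/P Fv; ring.
rewrite Fw Fv Jw in h.
apply: (mulfI vv); apply: (mulfI vv).
move: h; rewrite -/M -/W; move: (dot v v) (\sum_k _ * _) => d S h.
apply: (addIr (d * (2 * (d * (M - 2 * P)) * W - 2 * P * (d * W)))).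
by rewrite -mulrDr addrA h; ring.
Qed.

Definition mtrace (y : E) : R := partial ord0 (mcoef ord0) y - mcoef ord0 y * mcoef ord0 y.

Lemma mcoef_derivative y i j : U y ->
  partial i (mcoef j) y = mcoef i y * mcoef j y + (i == j)%:R * mtrace y.
Proof.
move=> Uy.
exact: (orthogonal_quadratic (D := fun l k => partial l (mcoef k) y) (m := mcoef^~ y)
  (fun v w => mcoef_derivative_orthogonal (v := v) (w := w) Uy)).
Qed.

End Dimension3.

(** * Christoffel symbols of a metric *)

Section Metric.
Context {R : realType} {n : nat}.
Local Notation E := 'rV[R]_n.+1.
Local Notation I := 'I_n.+1.
Variables (U : set E) (g : E -> 'M[R]_n.+1).
Hypothesis oU : open U.
Hypothesis gmetric : riemannian_metric U g.

Lemma metric_sym y i j : U y -> g y i j = g y j i.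
Proof. by have [_ gT _] := gmetric => Uy; rewrite -{1}(gT y Uy) mxE. Qed.

Lemma metric_smooth i j : smooth U (fun y => g y i j).
Proof. by have [gs _ _] := gmetric; exact: gs. Qed.

Lemma metric_unit y : U y -> g y \in unitmx.
Proof.
have [_ _ gpos] := gmetric => Uy; rewrite -row_free_unit; apply: inj_row_free => v vg.
apply: contrapT => /eqP v0; have := gpos y Uy v v0.
by rewrite /bform vg mul0mx mxE ltxx.
Qed.

Lemma metric_partial_sym y l i j : U y ->
  partial l (fun z => g z i j) y = partial l (fun z => g z j i) y.
Proof. by move=> Uy; apply: (partial_eq l oU Uy) => z Uz; exact: metric_sym. Qed.

Lemma christoffel_smooth k i j : smooth U (christoffel g k i j).
Proof.
rewrite /christoffel; apply: smoothM => //; first exact: smooth_cst.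
apply: smooth_sum => // l; apply: smoothM => //.
  by apply: smooth_invmx => // [x|a b]; [exact: metric_unit|exact: metric_smooth].
have sp a b c : smooth U (fun x => partial a (fun y => g y b c) x).
  by apply: smooth_partial; exact: metric_smooth.
by apply: smoothB => //; apply: smoothD.
Qed.

(** Lowering the index cancels the inverse metric of the definition. *)
Lemma christoffel_lower y i j a : U y -> \sum_k g y k a * christoffel g k i j y =
  2^-1 * (partial i (fun z => g z j a) y + partial j (fun z => g z i a) y
    - partial a (fun z => g z i j) y).
Proof.
move=> Uy; pose D l := partial i (fun z => g z j l) y + partial j (fun z => g z i l) y
    - partial l (fun z => g z i j) y.
rewrite -/(D a) /christoffel.
transitivity (2^-1 * \sum_l (\sum_k g y a k * invmx (g y) k l) * D l).
  rewrite mulr_sumr; under [RHS]eq_bigr do rewrite mulr_suml mulr_sumr.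
  rewrite exchange_big /=; apply: eq_bigr => k _.
  rewrite mulrCA !mulr_sumr; apply: eq_bigr => l _.
  by rewrite (metric_sym k a Uy) -/(D l) !mulrA.
congr (_ * _); rewrite (bigD1 a)//= [X in _ + X]big1 ?addr0; last first.
  move=> l la; have := congr1 (fun A : 'M[R]_n.+1 => A a l) (mulmxV (metric_unit Uy)).
  by rewrite !mxE eq_sym (negbTE la) => ->; rewrite mul0r.
have := congr1 (fun A : 'M[R]_n.+1 => A a a) (mulmxV (metric_unit Uy)).
by rewrite !mxE eqxx => ->; rewrite mul1r.
Qed.

Lemma metric_compat y l i j : U y -> partial l (fun z => g z i j) y =
  \sum_k g y k j * christoffel g k l i y + \sum_k g y k i * christoffel g k l j y.
Proof.
move=> Uy; rewrite !christoffel_lower// (metric_partial_sym l j i Uy).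
move: (partial l _ y) (partial i _ y) (partial j _ y) => a b c; lra.
Qed.

End Metric.

(** * Partial derivatives of expressions *)

Section PartialDerivatives.
Context {R : realType} {n : nat}.
Local Notation E := 'rV[R]_n.+1.
Local Notation I := 'I_n.+1.
Local Notation e_ i := (delta_mx 0 i : E).
Implicit Types (U : set E) (f g : E -> R) (x : E) (a : I).

(** Derivability and value are kept together, so that the derivative of an
    expression is built along the expression. *)
Definition pder a f (d : R) x := derivable f x (e_ a) /\ partial a f x = d.

Lemma smooth_pder U f x a : smooth U f -> U x -> pder a f (partial a f x) x.
Proof. by move=> sf Ux; split=> //; exact: smooth_derivable Ux. Qed.

Lemma pder_cst (k : R) x a : pder a (fun=> k) 0 x.
Proof. by split; [exact: derivable_cst | exact: (@derive_cst R E R k x (e_ a))]. Qed.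

Lemma pderD f g df dg x a : pder a f df x -> pder a g dg x ->
  pder a (fun y => f y + g y) (df + dg) x.
Proof. by move=> [hf <-] [hg <-]; split; [exact: derivableD|exact: partialD]. Qed.

Lemma pderM f g df dg x a : pder a f df x -> pder a g dg x ->
  pder a (fun y => f y * g y) (f x * dg + df * g x) x.
Proof.
move=> [hf <-] [hg <-]; split; first exact: derivableM.
by rewrite partialM// [g x * _]mulrC.
Qed.

Lemma pderZ k f df x a : pder a f df x -> pder a (fun y => k * f y) (k * df) x.
Proof.
by move=> hf; have := pderM (pder_cst k x a) hf; rewrite mul0r addr0.
Qed.

Lemma pderN f df x a : pder a f df x -> pder a (fun y => - f y) (- df) x.
Proof.
move=> [hf <-]; split; first exact: derivableN.
exact: deriveN.
Qed.

Lemma pderB f g df dg x a : pder a f df x -> pder a g dg x ->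
  pder a (fun y => f y - g y) (df - dg) x.
Proof. by move=> hf hg; exact: pderD hf (pderN hg). Qed.

Lemma pder_sum m (F : 'I_m -> E -> R) (dF : 'I_m -> R) x a :
  (forall i, pder a (F i) (dF i) x) -> pder a (fun y => \sum_i F i y) (\sum_i dF i) x.
Proof.
move=> hF.
have e : (fun y => \sum_i F i y) = \sum_i F i by apply/funext => y; rewrite fct_sumE.
split; first by rewrite e; apply: derivable_sum => i; exact: (hF i).1.
rewrite e /partial derive_sum; last by move=> i; exact: (hF i).1.
by apply: eq_bigr => i _; exact: (hF i).2.
Qed.

Lemma pderC U f (Fa Fb : E -> R) va vb x a b : open U -> U x -> smooth U f ->
  (forall y, U y -> pder a f (Fa y) y) -> (forall y, U y -> pder b f (Fb y) y) ->
  pder b Fa va x -> pder a Fb vb x -> va = vb.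
Proof.
move=> oU Ux sf ha hb [_ <-] [_ <-].
rewrite -(partial_eq b oU Ux (fun y Uy => (ha y Uy).2)).
by rewrite -(partial_eq a oU Ux (fun y Uy => (hb y Uy).2)) (partialC b a oU sf Ux).
Qed.

End PartialDerivatives.

(** * Beltrami's theorem and Schur's lemma *)

Section Contraction.
Context {R : realType} {n : nat}.
Local Notation I := 'I_n.
Variables (G : 'M[R]_n) (Q : I -> I -> R).
Hypothesis Gunit : G \in unitmx.
Hypothesis Gsym : G^T = G.
Local Notation H := (invmx G).

Let Gs i j : G i j = G j i. Proof. by rewrite -{1}Gsym mxE. Qed.
Let Hs i j : H i j = H j i.
Proof. by have := trmx_inv G; rewrite Gsym => e; rewrite -{1}e mxE. Qed.

Let GH b c : \sum_j G b j * H j c = (b == c)%:R.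
Proof. by have := congr1 (fun A : 'M[R]_n => A b c) (mulmxV Gunit); rewrite !mxE. Qed.

Lemma sum_kronecker (F : I -> R) b : \sum_i F i * (b == i)%:R = F b.
Proof.
by rewrite (bigD1 b)//= eqxx mulr1 big1 ?addr0// => i ib; rewrite eq_sym (negbTE ib) mulr0.
Qed.

Let contract (F : I -> R) b : \sum_i \sum_j H j i * (F i * G b j) = F b.
Proof.
rewrite -[RHS]sum_kronecker; apply: eq_bigr => i _; rewrite -GH mulr_sumr.
by apply: eq_bigr => j _; rewrite mulrC mulrA.
Qed.

Let contract' (F : I -> R) b : \sum_i \sum_j H j i * (F j * G b i) = F b.
Proof. by rewrite exchange_big -[RHS](contract F); do 2!apply: eq_bigr => ? _; rewrite Hs. Qed.

Let traceH : \sum_i \sum_j H j i * G i j = n%:R.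
Proof.
transitivity (\sum_(i < n) 1 : R); last by rewrite sumr_const card_ord.
apply: eq_bigr => i _; transitivity ((i == i)%:R : R); last by rewrite eqxx.
rewrite -GH.
by apply: eq_bigr => j _; rewrite mulrC.
Qed.

(** Contracting with the inverse of G over i and j gives
    (2 n + 2) (Q a b - Q b a) = 0.  With Q symmetric, contracting over b and j
    gives n Q = t G, where t is the trace of Q. *)
Lemma curvature_contraction :
  (forall a b i j, 2 * (Q a b - Q b a) * G i j + Q a i * G b j - Q b i * G a j
     + Q a j * G b i - Q b j * G a i = 0) ->
  exists k, forall a i, Q a i = k * G a i.
Proof.
move=> h.
have [n0|npos] := posnP n.
  by exists 0 => a; have := ltn_ord a; rewrite [X in (_ < X)%N]n0.
have nR : 0 < n%:R :> R by rewrite ltr0n.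
have Qs a b : Q a b = Q b a.
  have : \sum_i \sum_j H j i * (2 * (Q a b - Q b a) * G i j + Q a i * G b j - Q b i * G a j
     + Q a j * G b i - Q b j * G a i) = 0.
    by rewrite big1// => i _; rewrite big1// => j _; rewrite h mulr0.
  rewrite (_ : \sum_i _ = 2 * (Q a b - Q b a) * (\sum_i \sum_j H j i * G i j)
    + \sum_i \sum_j H j i * (Q a i * G b j) - \sum_i \sum_j H j i * (Q b i * G a j)
    + \sum_i \sum_j H j i * (Q a j * G b i) - \sum_i \sum_j H j i * (Q b j * G a i)).
    rewrite traceH !contract (contract' (Q a)) (contract' (Q b)) => e.
    have : (2 * n%:R + 2) * (Q a b - Q b a) = 0 by rewrite -e; ring.
    move/eqP; rewrite mulf_eq0 gt_eqF ?addr_gt0 ?mulr_gt0//= subr_eq0.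
    by move/eqP.
  rewrite mulr_sumr -big_split -sumrB -big_split -sumrB; apply: eq_bigr => i _ /=.
  rewrite mulr_sumr -big_split -sumrB -big_split -sumrB; apply: eq_bigr => j _ /=.
  by ring.
pose t := \sum_b \sum_j H j b * Q b j.
exists (t / n%:R) => a i.
have : \sum_b \sum_j H j b * (2 * (Q a b - Q b a) * G i j + Q a i * G b j - Q b i * G a j
     + Q a j * G b i - Q b j * G a i) = 0.
  by rewrite big1// => b _; rewrite big1// => j _; rewrite h mulr0.
rewrite (_ : \sum_b _ = Q a i * (\sum_b \sum_j H j b * G b j)
    - \sum_b \sum_j H j b * (Q b i * G a j)
    + \sum_b \sum_j H j b * (Q a j * G i b) - G a i * t).
  rewrite traceH (contract (Q^~ i)) (contract' (Q a)) => e.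
  apply: (mulIf (lt0r_neq0 nR)); rewrite mulrAC divfK ?lt0r_neq0//.
  by apply/eqP; rewrite -subr_eq0 -[X in _ == X]e; apply/eqP; ring.
rewrite /t !mulr_sumr -sumrB -big_split -sumrB; apply: eq_bigr => b _ /=.
rewrite !mulr_sumr -sumrB -big_split -sumrB; apply: eq_bigr => j _ /=.
by rewrite (Qs b a) (Gs b i); ring.
Qed.

End Contraction.

Section Schur.
Context {R : realType} {n : nat}.
Local Notation E := 'rV[R]_n.+2.
Local Notation I := 'I_n.+2.
Local Notation e_ i := (delta_mx 0 i : E).
Local Notation del i j := ((i == j)%:R : R).

(** The metric g has a connection in normal form, with one-form p and vector field
    m; dp stands for the partial derivatives of p, and rho is the function in
    those of m. *)
Variables (U : set E) (g : I -> I -> E -> R)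
  (p m : I -> E -> R) (dp : I -> I -> E -> R) (rho : E -> R).
Hypothesis oU : open U.
Hypothesis smg : forall i j, smooth U (g i j).
Hypothesis smp : forall i, smooth U (p i).
Hypothesis smm : forall i, smooth U (m i).
Hypothesis smdp : forall i j, smooth U (dp i j).
Hypothesis smrho : smooth U rho.
Hypothesis gS : forall y i j, U y -> g i j y = g j i y.
Hypothesis gU : forall y, U y -> (\matrix_(i, j) g i j y) \in unitmx.
Hypothesis g00 : forall y, U y -> g ord0 ord0 y != 0.

Let h j y := \sum_k m k y * g k j y.
Let pm y := \sum_k p k y * m k y.
Let mh y := \sum_k m k y * h k y.
Let s y := pm y + rho y.

Hypothesis Dp : forall y a k, U y -> pder a (p k) (dp a k y) y.
Hypothesis Dm : forall y a k, U y -> pder a (m k) (m a y * m k y + del a k * rho y) y.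
Hypothesis Dg : forall y a i j, U y -> pder a (g i j)
  (2 * (p a y * g i j y) + p i y * g a j y + p j y * g a i y
    - (del a i * h j y + del a j * h i y)) y.

Let sumk (F : I -> R) b : \sum_i F i * del b i = F b. Proof. exact: sum_kronecker. Qed.
Let delC (i j : I) : del i j = del j i. Proof. by rewrite eq_sym. Qed.

(** The field h is m with its index lowered; its derivative closes the system
    formed by Dp, Dm and Dg. *)
Let Dh y a j : U y -> pder a (h j) (rho y * g a j y + 2 * (p a y * h j y) + pm y * g a j y
   + p j y * h a y - del a j * mh y) y.
Proof.
move=> Uy; have := pder_sum (fun k => pderM (Dm a k Uy) (Dg a k j Uy)).
rewrite -/(h j) (_ : \sum_i _ = rho y * g a j y + 2 * (p a y * h j y) + pm y * g a j y
   + p j y * h a y - del a j * mh y)//.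
transitivity (\sum_k ((rho y * g k j y) * del a k + 2 * p a y * (m k y * g k j y)
   + g a j y * (p k y * m k y) + p j y * (m k y * g k a y) - del a j * (m k y * h k y)
   + (m a y * (m k y * g k j y) - h j y * m k y * del a k))).
  apply: eq_bigr => k _; rewrite (gS a k Uy).
  by move: (rho y) (p a y) (p k y) (p j y) (m a y) (m k y) (h j y) (h k y) (g k j y) (g k a y)
    (g a j y) (del a k) (del a j) => *; ring.
rewrite !(big_split, sumrN) /= -!mulr_sumr !sumk -/(h j y) -/(pm y) -/(mh y) -/(h a y).
by move: (rho y) (p a y) (p j y) (m a y) (h j y) (h a y) (pm y) (mh y) (g a j y) (del a j) => *;
  ring.
Qed.

(** The curvature is R^l_kij = del l j Q_ik - del l i Q_jk, plus
    (Q_ij - Q_ji) del l k as long as p is not known to be closed. *)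
Let Q i k y := dp i k y - p i y * p k y + s y * del i k.

(** The second derivatives of g commute. *)
Let riemann_antisym y a b i j : U y ->
  2 * (Q a b y - Q b a y) * g i j y + Q a i y * g b j y - Q b i y * g a j y
     + Q a j y * g b i y - Q b j y * g a i y = 0.
Proof.
move=> Uy.
pose F c z := 2 * (p c z * g i j z) + p i z * g c j z + p j z * g c i z
    - (del c i * h j z + del c j * h i z).
have DF c d := pderB (pderD (pderD (pderZ 2 (pderM (Dp c d Uy) (Dg c i j Uy)))
    (pderM (Dp c i Uy) (Dg c d j Uy))) (pderM (Dp c j Uy) (Dg c d i Uy)))
  (pderD (pderZ (del d i) (Dh c j Uy)) (pderZ (del d j) (Dh c i Uy))).
have e := pderC oU Uy (smg i j) (fun z Uz => Dg a i j Uz) (fun z Uz => Dg b i j Uz)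
  (DF b a) (DF a b).
move: e; rewrite /Q /s ?(gS j i Uy) ?(gS b a Uy) ?(delC j i) ?(delC b a).
rewrite ?(gS j b Uy) ?(gS i b Uy) ?(gS j a Uy) ?(gS i a Uy).
move: (dp a b y) (dp b a y) (dp a i y) (dp b i y) (dp a j y) (dp b j y) => x1 x2 x3 x4 x5 x6.
move: (p a y) (p b y) (p i y) (p j y) (h a y) (h b y) (h i y) (h j y) => x7 x8 x9 y1 y2 y3 y4 y5.
move: (g i j y) (g b j y) (g a j y) (g b i y) (g a i y) (g a b y) => z1 z2 z3 z4 z5 z6.
move: (del a i) (del a j) (del b i) (del b j) (del a b) (del i j) => d1 d2 d3 d4 d5 d6.
move: (pm y) (rho y) (mh y) => w1 w2 w3 e.
apply/eqP; rewrite -oppr_eq0; apply/eqP.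
move/eqP: e; rewrite -subr_eq0 => /eqP e; rewrite -[RHS]e; ring.
Qed.

(** The function K of Q = - K g, read off from one diagonal entry. *)
Definition curv y := - Q ord0 ord0 y / g ord0 ord0 y.

Let Dp_curv y i k : U y -> dp i k y = p i y * p k y - s y * del i k - curv y * g i k y.
Proof.
move=> Uy.
have [||k0 hk] := @curvature_contraction R n.+2 (\matrix_(i, j) g i j y)
  (fun i k => Q i k y) (gU Uy).
- by apply/matrixP => a b; rewrite !mxE gS.
- by move=> a b c d; rewrite !mxE; exact: riemann_antisym.
have kE : k0 = - curv y.
  by rewrite /curv hk mxE mulNr opprK mulfK// g00.
have := hk i k; rewrite mxE kE /Q => e.
apply/eqP; rewrite -subr_eq0 -[X in _ == X](subrr (- curv y * g i k y)) -{1}e; apply/eqP; ring.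
Qed.


Let smooth_curv : smooth U curv.
Proof.
have sM f f' : smooth U f -> smooth U f' -> smooth U (fun y => f y * f' y).
  exact: smoothM.
rewrite /curv /Q /s /pm; apply: (sM); last exact: smoothV.
apply: smoothN => //; apply: smoothD => //.
  by apply: smoothB => //; exact: (sM).
apply: (sM); last exact: smooth_cst.
by apply: smoothD => //; apply: smooth_sum => // k; exact: (sM).
Qed.

(** The second derivatives of m commute; b is an index other than a. *)
Let rho_partial y a : U y -> partial a rho y = rho y * m a y.
Proof.
move=> Uy; have [b ab] : exists b : I, a != b.
  by have [->|a0] := eqVneq a ord0; [exists ord_max|exists ord0].
have Dr c := smooth_pder c smrho Uy.
have DF c d k := pderD (pderM (Dm c d Uy) (Dm c k Uy)) (pderZ (del d k) (Dr c)).
have e := pderC oU Uy (smm b) (fun z Uz => Dm a b Uz) (fun z Uz => Dm b b Uz) (DF b a b) (DF a b b).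
move: e; rewrite !eqxx (negbTE ab) ?[b == a]eq_sym ?(negbTE ab).
move: (partial a rho y) (partial b rho y) (rho y) (m a y) (m b y) => ra rb r ma mb.
by rewrite /=; lra.
Qed.

Let Ds y a : U y -> pder a s (p a y * s y - curv y * h a y) y.
Proof.
move=> Uy; have Dr := smooth_pder a smrho Uy; rewrite rho_partial// in Dr.
have := pderD (pder_sum (fun k => pderM (Dp a k Uy) (Dm a k Uy))) Dr.
rewrite -/pm -/s (_ : \sum_i _ + _ = p a y * s y - curv y * h a y)//.
transitivity (\sum_k (p a y * (p k y * m k y) - s y * (m k y * del a k)
   - curv y * (m k y * g k a y) + m a y * (p k y * m k y) + rho y * (p k y * del a k))
   + rho y * m a y).
  congr (_ + _); apply: eq_bigr => k _; rewrite Dp_curv// (gS a k Uy).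
  by move: (p a y) (p k y) (m a y) (m k y) (s y) (curv y) (g k a y) (rho y) (del a k) => *; ring.
rewrite !(big_split, sumrN) /= -!mulr_sumr !sumk -/(h a y) -/(pm y) /s.
by move: (p a y) (m a y) (curv y) (h a y) (rho y) (pm y) => *; ring.
Qed.

(** Schur's lemma: the second derivatives of p commute, which reduces to
    d_a K g_bk = d_b K g_ak; raising k and taking b different from a gives
    d_a K = 0. *)
Let curv_partial y a : U y -> partial a curv y = 0.
Proof.
move=> Uy.
have Dc c := smooth_pder c smooth_curv Uy.
have DF c d k := pderB (pderB (pderM (Dp c d Uy) (Dp c k Uy))
  (pderM (Ds c Uy) (pder_cst (del d k) y c))) (pderM (Dc c) (Dg c d k Uy)).
have Dpc z c k : U z -> pder c (p k) (p c z * p k z - s z * del c k - curv z * g c k z) z.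
  by move=> Uz; rewrite -Dp_curv//; exact: Dp.
have key b k : partial a curv y * g b k y = partial b curv y * g a k y.
  have e := pderC oU Uy (smp k) (fun z Uz => Dpc z a k Uz) (fun z Uz => Dpc z b k Uz)
    (DF b a k) (DF a b k).
  move: e; rewrite !Dp_curv// ?(gS b a Uy) ?(delC b a).
  move: (partial a curv y) (partial b curv y) (p a y) (p b y) (p k y) (s y) (curv y).
  move: (g a b y) (g a k y) (g b k y) (del a b) (del a k) (del b k) (h a y) (h b y) (h k y).
  move=> x1 x2 x3 x4 x5 x6 x7 x8 x9 y1 y2 y3 y4 y5 y6 y7 e.
  apply/eqP; rewrite -subr_eq0; apply/eqP.
  move/eqP: e; rewrite -subr_eq0 => /eqP e; rewrite -[RHS]e; ring.
have [b ab] : exists b : I, a != b.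
  by have [->|a0] := eqVneq a ord0; [exists ord_max|exists ord0].
pose G := \matrix_(i, j) g i j y : 'M[R]_n.+2.
have GH c d : \sum_j g c j y * invmx G j d = del c d.
  have := congr1 (fun A : 'M[R]_n.+2 => A c d) (mulmxV (gU Uy)); rewrite !mxE => <-.
  by apply: eq_bigr => j _; rewrite !mxE.
have : partial a curv y * \sum_k g b k y * invmx G k b = partial b curv y * \sum_k g a k y * invmx G k b.
  by rewrite !mulr_sumr; apply: eq_bigr => k _; rewrite mulrA key mulrA.
by rewrite !GH eqxx (negbTE ab) mulr1 mulr0.
Qed.

(** This is Q = - K g.  It holds with K depending on the point because the
    Riemann tensor is antisymmetric, and the partial derivatives of K vanish. *)
Theorem projectively_flat_curvature : connected U ->
  exists K : R, forall y, U y -> forall i k,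
    dp i k y = p i y * p k y - (\sum_k p k y * m k y + rho y) * del i k - K * g i k y.
Proof.
move=> cU.
have [[y0 Uy0]|nU] := pselect (exists y, U y); last first.
  by exists 0 => y Uy; case: nU; exists y.
exists (curv y0) => y Uy i k.
rewrite (@partial0_constant R _ U curv oU cU _ _ y0 y Uy0 Uy).
- exact: Dp_curv.
- by move=> x a Ux; exact: smooth_derivable Ux.
- by move=> x a; exact: curv_partial.
Qed.

End Schur.

(** * Sectional curvature *)

Section Sectional.
Context {R : realType} {n : nat}.
Local Notation E := 'rV[R]_n.+1.
Local Notation I := 'I_n.+1.
Local Notation del i j := ((i == j)%:R : R).

(** The terms of the curvature in m cancel by the equation on the derivatives of
    m, and the derivatives of p are symmetric by the last two hypotheses. *)
Lemma riemann_coef_projectively_flat (U : set E) (g : E -> 'M[R]_n.+1)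
    (p m : I -> E -> R) (dp : I -> I -> E -> R) (rho : E -> R) (K : R) y l k i j :
  open U -> U y ->
  (forall z k i j, U z -> christoffel g k i j z =
    p i z * del k j + p j z * del k i - del i j * m k z) ->
  (forall a k, pder a (p k) (dp a k y) y) ->
  (forall a k, pder a (m k) (m a y * m k y + del a k * rho y) y) ->
  (forall i k, dp i k y =
    p i y * p k y - (\sum_k p k y * m k y + rho y) * del i k - K * g y i k) ->
  g y i j = g y j i ->
  riemann_coef g l k i j y = K * (del l i * g y j k - del l j * g y i k).
Proof.
move=> oU Uy form Dp Dm HK gS.
have DG a c i' j' : partial a (christoffel g c i' j') y = dp a i' y * del c j' + dp a j' y * del c i'
    - del i' j' * (m a y * m c y + del a c * rho y).
  have /esym := (pderB (pderD (pderM (Dp a i') (pder_cst (del c j') y a))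
    (pderM (Dp a j') (pder_cst (del c i') y a))) (pderZ (del i' j') (Dm a c))).2.
  rewrite !mulr0 !add0r => ->; apply: (partial_eq a oU Uy) => z Uz; exact: form.
set pm := \sum_k p k y * m k y in HK.
have GG i' j' : \sum_q christoffel g l i' q y * christoffel g q j' k y =
    p i' y * p j' y * del l k + p i' y * p k y * del l j' - p i' y * del j' k * m l y
    + del l i' * (2 * (p j' y * p k y) - del j' k * pm)
    - m l y * (p j' y * del i' k + p k y * del i' j' - del j' k * m i' y).
  pose X q := p j' y * del k q + p k y * del j' q - del j' k * m q y.
  transitivity (\sum_q (p i' y * (X q * del l q) + del l i' * (p q y * X q)
      - m l y * (X q * del i' q))).
    apply: eq_bigr => q _; rewrite !form// /X [q == j']eq_sym [q == k]eq_sym; ring.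
  rewrite !(big_split, sumrN) /= -!mulr_sumr !sum_kronecker.
  have -> : \sum_q p q y * X q = 2 * (p j' y * p k y) - del j' k * pm.
    transitivity (\sum_q (p j' y * (p q y * del k q) + p k y * (p q y * del j' q)
      - del j' k * (p q y * m q y))); first by apply: eq_bigr => q _; rewrite /X; ring.
    by rewrite !(big_split, sumrN) /= -!mulr_sumr !sum_kronecker -/pm; ring.
  by rewrite /X [k == l]eq_sym [j' == l]eq_sym [k == i']eq_sym [j' == i']eq_sym; ring.
rewrite /riemann_coef !DG.
rewrite sumrB !GG !HK [j == i]eq_sym gS [i == l]eq_sym [j == l]eq_sym.
clear HK GG DG.
move: (p i y) (p j y) (p k y) (m i y) (m j y) (m k y) (m l y) pm (rho y) => *.
move: (g y j i) (g y j k) (g y i k) => *.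
move: (del l i) (del l j) (del l k) (del i j) (del i k) (del j k) => *.
ring.
Qed.

Lemma bformDl (G : 'M[R]_n.+1) u v w : bform G (u + v) w = bform G u w + bform G v w.
Proof. by rewrite /bform !mulmxDl mxE. Qed.

Lemma bformZl (G : 'M[R]_n.+1) a u w : bform G (a *: u) w = a * bform G u w.
Proof. by rewrite /bform -!scalemxAl mxE. Qed.

Lemma bform_sym (G : 'M[R]_n.+1) u v : G^T = G -> bform G u v = bform G v u.
Proof.
move=> GT; rewrite /bform -[u *m G *m v^T]trmxK mxE !trmx_mul trmxK GT mulmxA.
by [].
Qed.

Lemma bformE (G : 'M[R]_n.+1) u v : bform G u v = \sum_i \sum_j G i j * u 0 i * v 0 j.
Proof.
rewrite /bform mxE exchange_big /=; apply: eq_bigr => j _; rewrite !mxE mulr_suml.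
by apply: eq_bigr => i _; rewrite [u 0 i * _]mulrC.
Qed.

(** The denominator of the sectional curvature is nonzero by the strict
    Cauchy-Schwarz inequality, that is, by positivity of g at
    g(v, v) u - g(u, v) v. *)
Lemma sectional_constant (g : E -> 'M[R]_n.+1) (x u v : E) (K : R) :
  (g x)^T = g x -> (forall w : E, w != 0 -> 0 < bform (g x) w w) ->
  (forall l k i j, riemann_coef g l k i j x =
    K * (del l i * g x j k - del l j * g x i k)) ->
  row_free (col_mx u v) -> sectional g x u v = K.
Proof.
move=> gT gpos hR free.
have RE : riemann g x u v v =
    K *: (bform (g x) v v *: u - bform (g x) u v *: v).
  apply/rowP => l; rewrite !mxE.
  transitivity (\sum_i \sum_j \sum_k (K * ((g x j k * v 0 j * v 0 k) * (u 0 i * del l i))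
    - K * ((g x i k * u 0 i * v 0 k) * (v 0 j * del l j)))).
    by do 3![apply: eq_bigr => ? _]; rewrite hR; ring.
  transitivity (\sum_i (K * bform (g x) v v) * (u 0 i * del l i)
    - \sum_j (K * bform (g x) u v) * (v 0 j * del l j)).
    rewrite [in X in _ = _ - X](eq_bigr (fun j => \sum_i \sum_k
      K * ((g x i k * u 0 i * v 0 k) * (v 0 j * del l j)))); last first.
      move=> j _; rewrite bformE mulr_sumr mulr_suml; apply: eq_bigr => i _.
      by rewrite mulr_sumr mulr_suml; apply: eq_bigr => k _; ring.
    rewrite [in X in _ = _ - X]exchange_big -sumrB; apply: eq_bigr => i _.
    rewrite bformE mulr_sumr mulr_suml -sumrB; apply: eq_bigr => j _.
    by rewrite mulr_sumr mulr_suml -sumrB; apply: eq_bigr => k _; ring.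
  by rewrite -!mulr_sumr !sum_kronecker; ring.
have uv0 (a b : R) : a *: u + b *: v = 0 -> a = 0 /\ b = 0.
  move=> h; have h2 : row_mx a%:M b%:M *m col_mx u v = 0 :> 'rV[R]_n.+1.
    by rewrite mul_row_col !mul_scalar_mx.
  have := mulmx_free_eq0 (row_mx a%:M b%:M : 'rV[R]_(1 + 1)) free.
  rewrite h2 eqxx => /esym; rewrite -row_mx0 => /eqP/eq_row_mx[ha hb].
  have := congr1 (fun A : 'M[R]_1 => A 0 0) ha; have := congr1 (fun A : 'M[R]_1 => A 0 0) hb.
  by rewrite !mxE eqxx !mulr1n.
have v0 : v != 0.
  apply/eqP => v0; have [] := uv0 0 1; last by move=> _ /eqP; rewrite oner_eq0.
  by rewrite v0 scale0r scaler0 addr0.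
have vv := gpos v v0.
set a := bform (g x) u u; set b := bform (g x) u v; set c := bform (g x) v v.
rewrite -/c in vv.
have w0 : c *: u + (- b) *: v != 0.
  by apply/eqP => /uv0[c0 _]; move: vv; rewrite c0 ltxx.
have bD z : bform (g x) z (c *: u + (- b) *: v) = c * bform (g x) z u - b * bform (g x) z v.
  by rewrite bform_sym// bformDl !bformZl ![bform _ _ z]bform_sym// mulNr.
have := gpos _ w0; rewrite bD !bformDl !bformZl -/a -/b -/c (bform_sym v u gT) -/b => pos.
have D0 : a * c - b ^+ 2 != 0.
  apply: contraTneq pos => e; rewrite -leNgt.
  by rewrite (_ : _ - _ = c * (a * c - b ^+ 2)); [rewrite e mulr0|ring].
rewrite /sectional RE bformZl -scaleNr bformDl !bformZl -/a -/b -/c (bform_sym v u gT) -/b.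
by apply: (mulIf D0); rewrite divfK//; ring.
Qed.

End Sectional.

Theorem theorem3p1 (R : realType) (U : set 'rV[R]_3)
    (g : 'rV[R]_3 -> 'M[R]_3) :
  region U ->
  riemannian_metric U g ->
  geodesics_are_circles U g ->
  constant_curvature U g.
Proof.
move=> [oU cU] gm circ; have [gsm gT gpos] := gm.
have CG k i j : smooth U (christoffel g k i j) by exact: christoffel_smooth.
have Gsym y k i j : U y -> christoffel g k i j y = christoffel g k j i y.
  exact: christoffel_sym.
have ci y v : U y -> exists lam : R, forall k,
    dot v v * geodesic_jerk g y v k
    - 3 * (\sum_i geodesic_acc g y v i * v 0 i) * geodesic_acc g y v k = lam * v 0 k.
  by apply: geodesic_circle_identity => // k i j; exact: CG.
have form y k i j := @christoffel_form R U g oU CG Gsym ci y k i j.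
have sp i : smooth U (pcoef g i) by exact: smooth_pcoef.
have sm i : smooth U (mcoef g i) by exact: smooth_mcoef.
have Dp y a k : U y -> pder a (pcoef g k) (partial a (pcoef g k) y) y by exact: smooth_pder.
have Dm y a k : U y -> pder a (mcoef g k) (mcoef g a y * mcoef g k y + (a == k)%:R * mtrace g y) y.
  move=> Uy; rewrite -(mcoef_derivative oU CG Gsym ci)//; exact: smooth_pder.
have srho : smooth U (mtrace g).
  by apply: smoothB => //; [exact: smooth_partial|exact: smoothM].
have sg i j : smooth U (fun y => g y i j) by exact: metric_smooth.
have sdp i j : smooth U (partial i (pcoef g j)) by exact: smooth_partial.
have gS y i j : U y -> g y i j = g y j i by exact: metric_sym.
have gU y : U y -> (\matrix_(i, j) g y i j) \in unitmx.
  move=> Uy; rewrite (_ : \matrix_(i, j) _ = g y); first exact: metric_unit.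
  by apply/matrixP => i j; rewrite mxE.
have g00 y : U y -> g y ord0 ord0 != 0.
  move=> Uy; have e0 : (delta_mx 0 ord0 : 'rV[R]_3) != 0.
    by apply/eqP => /(congr1 (fun v : 'rV[R]_3 => v 0 ord0)) /eqP; rewrite !mxE oner_eq0.
  have := gpos y Uy _ e0; rewrite bformE.
  by under eq_bigr do rewrite sum_delta; rewrite sum_delta => /lt0r_neq0.
have Dg y a i j : U y -> pder a (fun z => g z i j)
  (2 * (pcoef g a y * g y i j) + pcoef g i y * g y a j + pcoef g j y * g y a i
    - ((a == i)%:R * (\sum_k mcoef g k y * g y k j) + (a == j)%:R * \sum_k mcoef g k y * g y k i)) y.
  move=> Uy; split; first exact: smooth_derivable Uy.
  have lower b c : \sum_k g y k c * christoffel g k a b y =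
      pcoef g a y * g y b c + pcoef g b y * g y a c - (a == b)%:R * \sum_k mcoef g k y * g y k c.
    transitivity (\sum_k (pcoef g a y * (g y k c * (b == k)%:R) + pcoef g b y * (g y k c * (a == k)%:R)
      - (a == b)%:R * (mcoef g k y * g y k c))).
      by apply: eq_bigr => k _; rewrite form// [k == b]eq_sym [k == a]eq_sym; ring.
    by rewrite sumrB big_split /= -!mulr_sumr !sum_kronecker.
  rewrite (metric_compat oU gm)// !lower (gS y j i Uy).
  by move: (pcoef g a y) (pcoef g i y) (pcoef g j y) => *; ring.
have [K hK] := @projectively_flat_curvature R 1 U (fun i j y => g y i j) (pcoef g) (mcoef g)
  (fun a k => partial a (pcoef g k)) (mtrace g) oU sg sp sm sdp srho gS gU g00 Dp Dm Dg cU.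
exists K => x Ux u v free.
apply: sectional_constant free => [||l k i j]; [exact: gT|exact: gpos|].
apply: (@riemann_coef_projectively_flat R 2 U g (pcoef g) (mcoef g) (fun a k => partial a (pcoef g k))
  (mtrace g) K x l k i j) => //.
- by move=> a c; exact: Dp.
- by move=> a c; exact: Dm.
- by move=> a c; exact: hK.
- exact: gS.
Qed.
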